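(* Let $\lambda>0$. For each integer $n\ge\lambda$, let $\{\mathfrak{a},\mathfrak{b}\}$ be classically independent, where $\mathfrak{a}$ is a Bernoulli variable with parameter $\frac{\lambda}{n}$, and let $\{\mathfrak{a}_1,\mathfrak{b}_1\},\ldots,\{\mathfrak{a}_n,\mathfrak{b}_n\}$ be free copies of $\{\mathfrak{a},\mathfrak{b}\}$. Define $\mathfrak{N}_n=\sum_{i=1}^n\mathfrak{a}_i$ and $\mathfrak{S}_n=\sum_{i=1}^n\mathfrak{a}_i\mathfrak{b}_i$. Then, as $n\to\infty$: (i) $\mathfrak{S}_n$ is asymptotically free Poisson with rate $\mu>0$ and jump size $\alpha>0$ if and only if $\varphi((\alpha^{-1}\mathfrak{b})^m)=\frac{\mu}{\lambda}$ for all $m\ge1$. (ii) $\mathfrak{S}_n$ and $\mathfrak{N}_n-\mathfrak{S}_n$ are asymptotically free if and only if $\varphi(\mathfrak{b}^m)=\varphi(\mathfrak{b})$ for all $m\ge1$.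
   Context: A non-commutative probability space is a pair $(\mathcal{A},\varphi)$ with $\mathcal{A}$ a unital algebra over $\mathbb{C}$ and $\varphi:\mathcal{A}\to\mathbb{C}$ linear with $\varphi(\mathbf{1}_{\mathcal{A}})=1$. All variables (for a given $n$) live in such a space, which may depend on $n$ and whose state is always written $\varphi$. The distribution of $\mathfrak{b}$, i.e. its moments $\varphi(\mathfrak{b}^m)$, $m\ge1$, is arbitrary and does not depend on $n$. $\{\mathfrak{a},\mathfrak{b}\}$ classically independent means that $\mathfrak{a}$ and $\mathfrak{b}$ commute and $\varphi(\mathfrak{a}^i\mathfrak{b}^j)=\varphi(\mathfrak{a}^i)\varphi(\mathfrak{b}^j)$ for all $i,j\ge0$. $\mathfrak{a}$ is Bernoulli with parameter $p\in[0,1]$ if $\varphi(\mathfrak{a}^k)=p$ for all $k\ge1$. Free copies: each pair $(\mathfrak{a}_i,\mathfrak{b}_i)$ has the same joint distribution (joint moments of all non-commutative polynomials) as $(\mathfrak{a},\mathfrak{b})$, and the $n$ sets $\{\mathfrak{a}_i,\mathfrak{b}_i\}$ are freely independent. Unital subalgebras $(\mathcal{A}_i)_{i\in I}$ are freely independent if $\varphi(a_1\cdots a_k)=0$ whenever $k\ge1$, $a_j\in\mathcal{A}_{i_j}$, $\varphi(a_j)=0$ for all $j$, and $i_1\ne i_2,\ldots,i_{k-1}\ne i_k$; elements or sets are free if the unital subalgebras they generate are. Free cumulants $\kappa_r:\mathcal{A}^r\to\mathbb{C}$ are the multilinear functionals determined by $\varphi(a_1\cdots a_r)=\sum_{\pi\in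 NC(r)}\prod_{V\in\pi}\kappa_{|V|}(a_{i}:i\in V)$ (indices in each block in increasing order), $NC(r)$ being the set of non-crossing partitions of $\{1,\ldots,r\}$; $\kappa_r(a):=\kappa_r(a,\ldots,a)$. A variable $\mathfrak{p}$ is free Poisson with rate $\mu>0$ and jump size $\alpha>0$ if $\kappa_r(\mathfrak{p})=\mu\alpha^r$ for all $r\ge1$. Convergence in distribution of a tuple means convergence of $\varphi(P(\cdot))$ for every non-commutative polynomial $P$ to the corresponding value for a limiting tuple in some non-commutative probability space. ''Asymptotically free Poisson'' means convergence in distribution to a free Poisson variable; ''asymptotically free'' means joint convergence to freely independent variables. *)

(* Defs.v *)
(* The complex numbers are [R[i]] for R : realType; [R[i]^o] is the same type
   with its usual normed topology. *)
From HB Require Import structures.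
From mathcomp Require Import all_boot all_order all_algebra.
From mathcomp Require Import complex.
From mathcomp Require Import boolp classical_sets reals topology normedtype.
From mathcomp Require monalg.
Import numFieldNormedType.Exports.
(* The notations of monalg clash with those of MathComp-Analysis. *)
Import (canonicals, coercions) monalg.

Set Implicit Arguments.
Unset Strict Implicit.
Unset Printing Implicit Defensive.

Import Order.TTheory GRing.Theory Num.Theory.

Local Open Scope classical_set_scope.
Local Open Scope ring_scope.
Local Open Scope complex_scope.

Record ncps (R : realType) := NCPS {
  ncps_alg :> algType R[i];
  state : {scalar ncps_alg};
  state1 : state 1 = 1
}.

Notation "''phi' x" := (state _ x) (at level 10, x at level 9, format "''phi'  x").

(* Polynomials in k non-commuting variables: the algebra of the free monoid
   on 'I_k. *)
Definition ncpoly (R : realType) (k : nat) :=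
  monalg.malg (monalg.fmonom 'I_k) R[i].

Definition nceval (R : realType) (k : nat) (X : ncps R) (x : k.-tuple X)
    (P : ncpoly R k) : X :=
  monalg.mmap (in_alg X) (fun w : monalg.fmonom 'I_k =>
    \prod_(i <- monalg.fmonom_val w) tnth x i) P.

Definition same_joint_distribution (R : realType) (k : nat) (X Y : ncps R)
    (x : k.-tuple X) (y : k.-tuple Y) : Prop :=
  forall P : ncpoly R k, 'phi (nceval x P) = 'phi (nceval y P).

Definition cvg_in_distribution (R : realType) (k : nat) (X : nat -> ncps R)
    (x : forall n, k.-tuple (X n)) (Y : ncps R) (y : k.-tuple Y) : Prop :=
  forall P : ncpoly R k,
    (fun n => 'phi (nceval (x n) P) : R[i]^o) @ \oo
      --> ('phi (nceval y P) : R[i]^o).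

Definition classically_independent (R : realType) (X : ncps R) (a b : X)
    : Prop :=
  a * b = b * a /\
  forall i j : nat, 'phi (a ^+ i * b ^+ j) = 'phi (a ^+ i) * 'phi (b ^+ j).

Definition bernoulli (R : realType) (X : ncps R) (p : R) (a : X) : Prop :=
  0 <= p <= 1 /\ forall k : nat, (1 <= k)%N -> 'phi (a ^+ k) = p%:C.

Definition unital_subalgebra (R : realType) (A : algType R[i]) (B : set A)
    : Prop :=
  [/\ B 1,
      forall (c : R[i]) (x y : A), B x -> B y -> B (c *: x + y) &
      forall x y : A, B x -> B y -> B (x * y)].

Definition generated_subalgebra (R : realType) (A : algType R[i]) (G : set A)
    : set A :=
  smallest (@unital_subalgebra R A) G.

Definition free_subalgebras (R : realType) (X : ncps R) (I : Type)
    (B : I -> set X) : Prop :=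
  forall (k : nat) (i : nat -> I) (x : nat -> X),
    (1 <= k)%N ->
    (forall j, (j < k)%N -> B (i j) (x j) /\ 'phi (x j) = 0) ->
    (forall j, (j.+1 < k)%N -> i j <> i j.+1) ->
    'phi (\prod_(0 <= j < k) x j) = 0.

Definition freely_independent (R : realType) (X : ncps R) (I : Type)
    (G : I -> set X) : Prop :=
  free_subalgebras (fun i => generated_subalgebra (G i)).

Definition free_copies (R : realType) (X : ncps R) (a b : X) (n : nat)
    (a_ b_ : 'I_n -> X) : Prop :=
  (forall i, same_joint_distribution [tuple a_ i; b_ i] [tuple a; b]) /\
  freely_independent (fun i => [set a_ i; b_ i]).

Definition noncrossing (r : nat) (P : {set {set 'I_r}}) : bool :=
  [forall V in P, forall W in P,
   forall i : 'I_r, forall j : 'I_r, forall k : 'I_r, forall l : 'I_r,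
     [&& (i < j)%N, (j < k)%N, (k < l)%N, i \in V, k \in V, j \in W & l \in W]
     ==> (V == W)].

Definition NC (r : nat) : {set {set {set 'I_r}}} :=
  [set P : {set {set 'I_r}} | finset.partition P [set: 'I_r] & noncrossing P]%SET.

(* [kappa] gathers all the functionals kappa_r: kappa_r is its restriction to
   the sequences of size r, and its value at [::] plays no role. As [enum V]
   lists V in increasing order, so does the argument of each factor. *)
Definition free_cumulants (R : realType) (X : ncps R) (kappa : seq X -> R[i])
    : Prop :=
  (forall (s1 s2 : seq X) (c : R[i]) (x y : X),
     kappa (s1 ++ (c *: x + y) :: s2) =
     c * kappa (s1 ++ x :: s2) + kappa (s1 ++ y :: s2)) /\
  (forall s : seq X, (1 <= size s)%N ->
     'phi (\prod_(x <- s) x) =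
     \sum_(P in NC (size s)) \prod_(V in P)
       kappa [seq tnth (in_tuple s) i | i <- enum V]).

(* Exactly one kappa, up to its value at [::], satisfies [free_cumulants]. *)
Definition free_poisson (R : realType) (X : ncps R) (mu alpha : R) (p : X)
    : Prop :=
  exists kappa : seq X -> R[i], free_cumulants kappa /\
    forall r : nat, (1 <= r)%N -> kappa (nseq r p) = (mu * alpha ^+ r)%:C.

Definition asymptotically_free_poisson (R : realType) (X : nat -> ncps R)
    (x : forall n, X n) (mu alpha : R) : Prop :=
  exists (Y : ncps R) (p : Y), free_poisson mu alpha p /\
    cvg_in_distribution (fun n => [tuple x n]) [tuple p].

Definition asymptotically_free (R : realType) (k : nat) (X : nat -> ncps R)
    (x : forall n, k.-tuple (X n)) : Prop :=
  exists (Y : ncps R) (y : k.-tuple Y),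
    freely_independent (fun i : 'I_k => [set tnth y i]) /\
    cvg_in_distribution x y.

(* Main.v *)
From HB Require Import structures.
Require Import Defs.
From mathcomp Require Import all_boot all_order all_algebra.
From mathcomp Require Import complex.
From mathcomp Require Import boolp classical_sets reals topology normedtype.
From mathcomp Require Import ring zify.
From mathcomp Require finmap monalg.
Import numFieldNormedType.Exports.
Import (canonicals, coercions) finmap.
Import (canonicals, coercions) monalg.

Set Implicit Arguments.
Unset Strict Implicit.
Unset Printing Implicit Defensive.

Import Order.TTheory GRing.Theory Num.Theory.
Local Open Scope ring_scope.
Local Open Scope complex_scope.

(** Free cumulants are handled through a stack. Read a word of generators from
left to right; each letter is either pushed on the stack, or closes a block
formed by itself and some letters on the top of the stack, which are popped
with the cumulant of that block as a weight. The runs that end with an empty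
stack are the non-crossing partitions of the word, so that the total weight
[mom kap w] of the runs is the moment given by the moment-cumulant formula
([mom_noncrossing]). One letter acts on functions of the stack by the operator
[step kap a]: this is the full Fock space realisation of a family with given
joint free cumulants, and it replaces the combinatorics of partitions by
operator identities.

- Cumulants with prescribed moments exist and are unique, because the moment of
a word is the cumulant of the whole word plus terms in shorter cumulants
([fock_leading], [mom_cumulants_of], [mom_inj]).
- When the cumulants of words of mixed colours vanish, an operator of a given
colour only sees the letters of that colour on the top of the stack. A centred
operator therefore always leaves letters of its colour there, and an
alternating product of centred operators never comes back to the empty stack:
the colours are free ([fock_free]).
- Freeness and the moments within each colour determine all joint moments, so a
free family has the moments of the Fock model ([free_mom]).
- The sum over [n] colours of identically distributed operators is again such
an operator, with cumulants multiplied by [n] ([colour_sum_mom]).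

Apply this to the letters [a_i b_i] and [a_i - a_i b_i]. By classical
independence the moment of a nonempty word of these letters is
[lambda / n * phi (q(b))], where [q] is the product of one factor ['X] or
[1 - 'X] per letter. A product of at least two cumulants is of order [n^-2], so
that [n] times the cumulant of the word has the same limit
[lambda * phi (q(b))] as [n] times its moment ([clim_cumulants_of]); these are
the cumulants of the limit of [(S, N - S)] ([limit_moments]).

The limit of [S] has cumulants [lambda * phi (b ^+ r)], and is free Poisson if
and only if they are [mu * alpha ^+ r], as cumulants are determined by moments.
The limits of [S] and [N - S] are free if and only if the mixed limit cumulants
vanish. Those of the words with a single letter [N - S] are
[lambda * (phi (b ^+ m) - phi (b ^+ m.+1))], so vanishing makes the moments of
[b] constant; conversely every mixed product is a multiple of ['X * (1 - 'X)],
which is killed when the moments are constant. *)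

(** * Moments from cumulants by a stack *)

Section Stack.
Context (C : comNzRingType) (A : Type).
Implicit Types (k g h kap : seq A -> C) (a b : A) (s t u w : seq A).

Definition conv k g s : C :=
  \sum_(r < (size s).+1) k (take r s) * g (drop r s).

(** Pushing [a], plus closing the block of [a] with the top [r] letters of the
stack for every [r]. The argument of [kap] lists the block from its last letter
down to its first, hence the reversals below. *)
Definition step kap a g : seq A -> C :=
  fun s => g (a :: s) + conv (fun t => kap (a :: t)) g s.

Definition vac s : C := (nilp s)%:R.

Definition fock kap w : seq A -> C := foldr (step kap) vac w.

Definition mom kap w : C := fock kap w [::].

Lemma conv_nil k g : conv k g [::] = k [::] * g [::].
Proof. by rewrite /conv big_ord1. Qed.

Lemma conv_cons k g a s :
  conv k g (a :: s) = k [::] * g (a :: s) + conv (fun t => k (a :: t)) g s.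
Proof. by rewrite /conv big_ord_recl. Qed.

Lemma eq_conv k k' g g' s :
  (forall t u, t ++ u = s -> k t * g u = k' t * g' u) ->
  conv k g s = conv k' g' s.
Proof. by move=> E; apply: eq_bigr => r _; rewrite E// cat_take_drop. Qed.

Lemma conv_linearl c k k' g s :
  conv (fun t => c * k t + k' t) g s = c * conv k g s + conv k' g s.
Proof.
rewrite /conv mulr_sumr -big_split/=; apply: eq_bigr => r _.
by rewrite mulrDl mulrA.
Qed.

Lemma conv_linearr c k g g' s :
  conv k (fun t => c * g t + g' t) s = c * conv k g s + conv k g' s.
Proof.
rewrite /conv mulr_sumr -big_split/=; apply: eq_bigr => r _.
by rewrite mulrDr mulrCA.
Qed.

Lemma conv_vac k s : conv k vac s = k s.
Proof.
elim: s k => [|a s IH] k; first by rewrite conv_nil mulr1.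
by rewrite conv_cons mulr0 add0r IH.
Qed.

Lemma foldr_stepZ kap c g w s :
  foldr (step kap) (fun t => c * g t) w s = c * foldr (step kap) g w s.
Proof.
elim: w s => [//|a w IH] s /=.
rewrite /step IH mulrDr; congr (_ + _).
by rewrite /conv mulr_sumr; apply: eq_bigr => r _; rewrite IH mulrCA.
Qed.

(** The operators generated by the letters satisfying [p]: what they do to a
stack depends only on its maximal top segment [u] of such letters, and they
leave the part [w] underneath untouched. This is the free product structure of
the Fock space, seen on functions of the stack. *)
Definition local_on (p : pred A) (T : (seq A -> C) -> seq A -> C) :=
  forall g h u w, all p u -> (if w is b :: _ then ~~ p b else true) ->
    (forall u', all p u' -> g (u' ++ w) = h u') -> T g (u ++ w) = T h u.

Lemma conv_local (p : pred A) k g h u w :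
    (forall t, ~~ all p t -> k t = 0) ->
    all p u -> (if w is b :: _ then ~~ p b else true) ->
    (forall u', all p u' -> g (u' ++ w) = h u') ->
  conv k g (u ++ w) = conv k h u.
Proof.
elim: u k g h => [|b u IH] k g h k0 pu pw E.
  rewrite cat0s conv_nil -(E [::])//=; case: w pw {E} => [|c w] pc.
    by rewrite conv_nil.
  rewrite conv_cons [X in _ + X]big1 ?addr0// => r _.
  by rewrite k0 ?mul0r//= (negbTE pc).
move: pu => /= /andP[pb pu].
rewrite -/(cat (b :: u) w) !conv_cons -cat_cons E ?(IH _ _ h)//=;
  last by rewrite pb.
by move=> t pt; rewrite k0//= pb.
Qed.

Lemma local_step (p : pred A) kap a : p a ->
  (forall t, ~~ all p t -> kap (a :: t) = 0) -> local_on p (step kap a).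
Proof.
move=> pa kap0 g h u w pu pw E; rewrite /step -cat_cons E;
  last by rewrite /= pa.
by rewrite (conv_local (h := h) kap0 pu pw E).
Qed.

Lemma eq_fock kap kap' w s :
    (forall t, (0 < size t <= size w + size s)%N -> kap t = kap' t) ->
  fock kap w s = fock kap' w s.
Proof.
elim: w s => [//|a w IH] s E; rewrite /= /step IH.
  congr (_ + _); apply: eq_conv => t u Es.
  rewrite E ?IH//; last by rewrite -Es size_cat/=; lia.
  by move=> v Hv; apply: E; move: Hv; rewrite -Es size_cat/=; lia.
by move=> v Hv; apply: E; move: Hv => /=; lia.
Qed.

Lemma fock1 kap a s : fock kap [:: a] s = kap (a :: s).
Proof. by rewrite /fock/= /step conv_vac/= add0r. Qed.

(** The only run that closes a single block containing everything weighs
[kap (rev w ++ s)]; all the other runs involve strictly shorter blocks. *)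
Lemma fock_leading kap kap' w s : (0 < size w)%N ->
    (forall t, (0 < size t < size w + size s)%N -> kap t = kap' t) ->
  fock kap w s - kap (rev w ++ s) = fock kap' w s - kap' (rev w ++ s).
Proof.
case: w => // a w _; elim: w a s => [|b w IH] a s E.
  by rewrite !fock1 !subrr.
rewrite [fock kap _ _]/= [fock kap' _ _]/= {1 2}/step.
rewrite rev_cons cat_rcons [LHS]addrAC [RHS]addrAC; congr (_ + _).
  by apply: IH => t Ht; apply: E; move: Ht => /=; lia.
apply: eq_conv => t u Es; rewrite E; last by rewrite -Es size_cat/=; lia.
congr (_ * _); apply: (@eq_fock _ _ (b :: w)) => v Hv; apply: E.
by move: Hv; rewrite -Es size_cat/=; lia.
Qed.

Lemma mom_inj kap kap' :
  (forall w, (0 < size w)%N -> mom kap w = mom kap' w) ->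
  forall w, (0 < size w)%N -> kap w = kap' w.
Proof.
move=> E w; have [n] := ubnP (size w); elim: n w => // n IH w Hn w0.
have := @fock_leading kap kap' (rev w) [::].
rewrite size_rev => /(_ w0) H.
have {}H : mom kap (rev w) - kap w = mom kap' (rev w) - kap' w.
  rewrite /mom -{2 4}(revK w) -[rev (rev w)]cats0; apply: H => t Ht.
  by apply: IH; move: Ht => /=; lia.
have := H; rewrite E ?size_rev// => /addrI/oppr_inj //.
Qed.

(** Cumulants of words of length at most [n], set to zero beyond: by
[fock_leading] the cumulant of a word is its moment minus the moment computed
with the shorter cumulants. *)
Fixpoint cumulants_upto (mu : seq A -> C) n : seq A -> C :=
  if n is n'.+1 then fun t =>
    if size t == n then mu (rev t) - mom (cumulants_upto mu n') (rev t)
    else cumulants_upto mu n' t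
  else fun=> 0.

Definition cumulants_of mu t := cumulants_upto mu (size t) t.

Lemma cumulants_upto_big mu n t : (n < size t)%N -> cumulants_upto mu n t = 0.
Proof. by elim: n => //= n IH nt; rewrite gtn_eqF// IH// ltnW. Qed.

Lemma cumulants_uptoE mu n t : (size t <= n)%N ->
  cumulants_upto mu n t = cumulants_of mu t.
Proof.
elim: n => [|n IH]; first by rewrite leqn0 => /nilP->.
rewrite leq_eqVlt => /predU1P[<-//|tn] /=.
by rewrite ltn_eqF// IH.
Qed.

Lemma mom_cumulants_of mu w : (0 < size w)%N -> mom (cumulants_of mu) w = mu w.
Proof.
move=> w0; have [n sw] : exists n, size w = n.+1.
  by exists (size w).-1; rewrite prednK.
have /eqP := @fock_leading (cumulants_of mu) (cumulants_upto mu n) w [::] w0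
  (fun t => ltac:(by rewrite addn0 sw ltnS => /andP[_ tn];
    rewrite cumulants_uptoE)).
rewrite cats0 (@cumulants_upto_big _ _ (rev w)) ?size_rev ?sw// subr0 subr_eq
  => /eqP.
rewrite -/(mom _ w) => ->.
by rewrite /cumulants_of size_rev sw /= size_rev sw eqxx revK addrC subrK.
Qed.

End Stack.

Lemma fock_map (C : comNzRingType) (A B : Type) (f : A -> B) (p : pred A)
    (kap : seq A -> C) (kap' : seq B -> C) (w s : seq A) :
    (forall a t, all p (a :: t) -> kap (a :: t) = kap' (map f (a :: t))) ->
    all p w -> all p s ->
  fock kap w s = fock kap' (map f w) (map f s).
Proof.
move=> E; elim: w s => [|a w IH] s /=; first by case: s.
move=> /andP[pa pw] ps; rewrite /step (IH (a :: s)) ?IH//=; last by rewrite pa.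
congr (_ + _); rewrite /conv size_map; apply: eq_bigr => r _.
have := ps; rewrite -{1}(cat_take_drop r s) all_cat => /andP[pt pd].
by rewrite -map_take -map_drop IH// E//= pa.
Qed.

Section Multilinear.
Context (C : comNzRingType) (V : lmodType C).
Implicit Types (k g kap : seq V -> C).

Definition multilinear k := forall s1 s2 c x y,
  k (s1 ++ (c *: x + y) :: s2) = c * k (s1 ++ x :: s2) + k (s1 ++ y :: s2).

(** In each term of the deconcatenation a given letter occurs in exactly one of
the two factors. *)
Lemma multilinear_conv k g :
  multilinear k -> multilinear g -> multilinear (conv k g).
Proof.
move=> Lk Lg s1; elim: s1 k Lk => [|b s1 IH] k Lk s2 c x y /=.
  rewrite !conv_cons (Lg [::]) mulrDr mulrDr addrACA [c * (k _ * _)]mulrCA.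
  congr (_ + _); rewrite -conv_linearl; apply: eq_conv => t u _.
  by rewrite (Lk [::]).
rewrite !conv_cons (Lg (b :: s1)) IH; last by move=> t; exact: (Lk (b :: t)).
by ring.
Qed.

Lemma multilinear_fock kap w : multilinear kap -> multilinear (fock kap w).
Proof.
move=> Lk; elim: w => [|a w IH] s1 s2 c x y.
  by case: s1 => [|? ?]; rewrite /fock/vac/=; ring.
rewrite /= /step (IH (a :: s1)) multilinear_conv//; first by ring.
by move=> t; exact: (Lk (a :: t)).
Qed.

Lemma multilinear_fock_word kap s : multilinear kap ->
  multilinear (fun w => fock kap w s).
Proof.
move=> Lk w1; elim: w1 s => [|b w1 IH] s w2 c x y /=.
  rewrite /step (multilinear_fock w2 Lk [::] s).
  rewrite (eq_conv (k' := fun t => c * kap (x :: t) + kap (y :: t))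
    (g' := fock kap w2)); first by rewrite conv_linearl; ring.
  by move=> t u _; rewrite (Lk [::]).
rewrite /step IH (eq_conv (k' := fun t => kap (b :: t))
  (g' := fun u => c * fock kap (w1 ++ x :: w2) u + fock kap (w1 ++ y :: w2) u)).
  by rewrite conv_linearr; ring.
by move=> t u _; rewrite IH.
Qed.

Lemma multilinear_rev k : multilinear k -> multilinear (k \o rev).
Proof.
by move=> Lk s1 s2 c x y; rewrite /= !rev_cat !rev_cons !cat_rcons Lk.
Qed.

Lemma multilinear_cumulants_of mu : multilinear mu ->
  multilinear (cumulants_of mu).
Proof.
move=> Lm; have L n : multilinear (cumulants_upto mu n).
  elim: n => [|n IH] s1 s2 c x y /=; first by ring.
  rewrite !size_cat/=; case: ifP => _; last exact: IH.
  have /= -> := multilinear_rev Lm s1 s2 c x y.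
  have /= := multilinear_rev (multilinear_fock_word [::] IH) s1 s2 c x y.
  by rewrite /mom => ->; ring.
by move=> s1 s2 c x y; rewrite /cumulants_of !size_cat /= L.
Qed.
End Multilinear.

Section Colours.
Context (C : comNzRingType) (I : finType) (D : Type).
Implicit Types (k g kap : seq (I * D) -> C).

Fixpoint colour_sum g (s : seq D) : C :=
  if s is d :: s' then
    \sum_i colour_sum (fun t => g ((i, d) :: t)) s'
  else g [::].

Lemma eq_colour_sum g g' s : g =1 g' -> colour_sum g s = colour_sum g' s.
Proof.
by elim: s g g' => //= d s IH g g' E; apply: eq_bigr => i _; exact: IH.
Qed.

Lemma colour_sum_sum (J : Type) (r : seq J) (c : J -> C)
    (F : J -> seq (I * D) -> C) s :
  colour_sum (fun t => \sum_(j <- r) c j * F j t) s =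
  \sum_(j <- r) c j * colour_sum (F j) s.
Proof.
elim: s F => //= d s IH F.
under eq_bigr do rewrite IH.
by rewrite exchange_big; apply: eq_bigr => j _; rewrite mulr_sumr.
Qed.

Lemma colour_sumD g g' s :
  colour_sum (fun t => g t + g' t) s = colour_sum g s + colour_sum g' s.
Proof.
elim: s g g' => //= d s IH g g'.
by under eq_bigr do rewrite IH; rewrite big_split.
Qed.

Lemma colour_sumZ c g s : colour_sum (fun t => c * g t) s = c * colour_sum g s.
Proof.
elim: s g => //= d s IH g.
by under eq_bigr do rewrite IH; rewrite mulr_sumr.
Qed.

Lemma colour_sum0 s : colour_sum (fun=> 0) s = 0.
Proof. by elim: s => //= d s IH; rewrite big1. Qed.

Lemma colour_sum_vac s : colour_sum (@vac C _) s = vac C s.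
Proof. by case: s => //= d s; rewrite big1// => i _; exact: colour_sum0. Qed.

Lemma colour_sum_conv k g s : colour_sum (conv k g) s =
  conv (colour_sum k) (colour_sum g) s.
Proof.
elim: s k g => [|d s IH] k g; first by rewrite /= !conv_nil.
rewrite conv_cons /= mulr_sumr.
under eq_bigr => i _.
  rewrite (@eq_colour_sum _ (fun t =>
    k [::] * g ((i, d) :: t) + conv (fun u => k ((i, d) :: u)) g t)).
    by rewrite colour_sumD colour_sumZ IH; over.
  by move=> t; rewrite conv_cons.
rewrite big_split/=; congr (_ + _).
rewrite /conv exchange_big; apply: eq_bigr => r _ /=; rewrite mulr_suml//.
Qed.

(** Summing over colours commutes with the Fock operators, because the colours
of the popped letters and those of the remaining ones are independent. *)
Lemma colour_sum_step kap d g s :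
  \sum_i colour_sum (step kap (i, d) g) s =
    step (colour_sum kap) d (colour_sum g) s.
Proof.
under eq_bigr do rewrite /step colour_sumD colour_sum_conv.
rewrite big_split /=; congr (_ + _).
rewrite /conv exchange_big; apply: eq_bigr => r _ /=; rewrite mulr_suml//.
Qed.

Lemma colour_sum_fock kap w s :
  colour_sum (fun cw => colour_sum (fock kap cw) s) w =
    fock (colour_sum kap) w s.
Proof.
elim: w s => [|d w IH] s /=; first by rewrite /fock/= colour_sum_vac.
transitivity (colour_sum (fun cw =>
  step (colour_sum kap) d (colour_sum (fock kap cw)) s) w).
  rewrite (@eq_colour_sum
    (fun cw => step (colour_sum kap) d (colour_sum (fock kap cw)) s)
    (fun cw => \sum_i 1 * colour_sum (step kap (i, d) (fock kap cw)) s)).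
    by rewrite colour_sum_sum; apply: eq_bigr => i _; rewrite mul1r.
  by move=> cw; rewrite -colour_sum_step; apply: eq_bigr => i _; rewrite mul1r.
rewrite /step colour_sumD -IH; congr (_ + _).
by rewrite colour_sum_sum; apply: eq_bigr => r _; rewrite IH.
Qed.

Lemma colour_sum_mom kap w : colour_sum (mom kap) w = mom (colour_sum kap) w.
Proof. by rewrite /mom -colour_sum_fock. Qed.

Lemma state_prod_sum (X : nzRingType) (phi : {additive X -> C})
    (x : I * D -> X) w :
  phi (\prod_(d <- w) \sum_i x (i, d)) =
  colour_sum (fun t => phi (\prod_(a <- t) x a)) w.
Proof.
suff E y : phi (y * \prod_(d <- w) \sum_i x (i, d)) =
    colour_sum (fun t => phi (y * \prod_(a <- t) x a)) w.
  by rewrite -[X in phi X]mul1r E; apply: eq_colour_sum => t; rewrite mul1r.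
elim: w y => [|d w IH] y /=; first by rewrite !big_nil.
rewrite big_cons mulr_suml mulr_sumr raddf_sum; apply: eq_bigr => i _.
by rewrite mulrA IH; apply: eq_colour_sum => t; rewrite big_cons mulrA.
Qed.

End Colours.

(** The cumulants of identically distributed free colours. *)
Definition monochrome (C : comNzRingType) (I : eqType) (D : Type)
    (kap : seq D -> C) (t : seq (I * D)) : C :=
  if t is a :: t' then
    if all (fun x => x.1 == a.1) t' then kap (map snd t) else 0
  else 0.

Lemma colour_sum_all_eq (C : comNzRingType) (I : finType) (D : Type) (i : I)
    (k : seq D -> C) (t : seq D) :
  colour_sum (fun u =>
    if all (fun x : I * D => x.1 == i) u then k (map snd u) else 0) t = k t.
Proof.
elim: t k => //= e t IH k.
rewrite (bigD1 i)//= eqxx (IH (fun t => k (e :: t))) big1 ?addr0//.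
by move=> j /negbTE->; exact: colour_sum0.
Qed.

Lemma colour_sum_monochrome (C : comNzRingType) (I : finType) (D : Type)
    (kap : seq D -> C) (t : seq D) : (0 < size t)%N ->
  colour_sum (monochrome (I := I) kap) t = #|I|%:R * kap t.
Proof.
case: t => // d t _ /=; rewrite (eq_bigr (fun=> kap (d :: t))).
  by rewrite sumr_const mulr_natl.
move=> i _; exact: (colour_sum_all_eq i (fun t => kap (d :: t))).
Qed.

(** * Non-crossing partitions *)

Section NonCrossing.
Import mathcomp.boot.finset.
Context (N : nat).
Implicit Types (P Q : {set {set 'I_N}}) (V W D : {set 'I_N}) (s w : seq 'I_N).
Local Open Scope set_scope.

Let lt_ord := fun i j : 'I_N => (i < j)%N.

Lemma lt_ord_trans : transitive lt_ord.
Proof. by move=> i j k; exact: ltn_trans. Qed.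

Lemma noncrossingP P : reflect
  (forall V W (i j k l : 'I_N), V \in P -> W \in P ->
     (i < j < k)%N -> (k < l)%N -> i \in V -> k \in V -> j \in W -> l \in W ->
     V = W) (noncrossing P).
Proof.
apply: (iffP forall_inP) => [H V W i j k l VP WP /andP[ij jk] kl iV kV jW lW|
    H V VP].
  have /forall_inP/(_ _ WP)/forallP/(_ i)/forallP/(_ j) := H _ VP.
  move=> /forallP/(_ k)/forallP/(_ l).
  by rewrite ij jk kl iV kV jW lW => /eqP.
apply/forall_inP => W WP; do 4!apply/forallP => ?.
apply/implyP => /and5P[ij jk kl iV /and3P[kV jW lW]].
by apply/eqP; apply: (H _ _ _ _ _ _ VP WP _ kl iV kV jW lW); rewrite ij.
Qed.

Definition open_in w P := [forall V in P, [exists x in V, x \in w]].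

(** The non-crossing partitions counted by [fock kap w s]: those of the pending
letters [s] and the unread letters [w] in which no block is already closed. *)
Definition pending s w P := [&& partition P [set x in s ++ w],
  noncrossing P & open_in w P].

Lemma pendingP s w P : reflect
  [/\ partition P [set x in s ++ w], noncrossing P &
     forall V, V \in P -> exists2 x, x \in V & x \in w] (pending s w P).
Proof.
apply: (iffP and3P) => -[pP nP oP]; split => //.
  by move=> V VP; exact/exists_inP/(forall_inP oP).
by apply/forall_inP => V VP; exact/exists_inP/oP.
Qed.

Lemma pending_nil s P : pending s [::] P = (s == [::]) && (P == set0).
Proof.
apply/pendingP/andP => [[pP _ oP]|[/eqP-> /eqP->]].
  have P0 : P = set0.
    by apply/setP => V; rewrite inE; apply/negP => /oP[x].
  split; last by rewrite P0.
  move: pP; rewrite P0 => /cover_partition; rewrite /cover big_set0 cats0.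
  by case: s => // c s /setP/(_ c); rewrite !inE eqxx.
split.
- by rewrite [X in partition _ X](_ : _ = set0) ?partition_set0.
- by apply/noncrossingP => V W ????; rewrite inE.
- by move=> V; rewrite inE.
Qed.

Lemma filter_prefix (T : eqType) (p : pred T) (s : seq T) :
  (forall (s1 : seq T) x (s2 : seq T), s = s1 ++ x :: s2 -> p x -> all p s1) ->
  [seq x <- s | p x] = take (count p s) s.
Proof.
elim: s => //= b s IH H; have [pb|pb] := boolP (p b).
  rewrite add1n/= IH// => s1 x s2 E px.
  by have := H (b :: s1) x s2; rewrite E /= => /(_ erefl px)/andP[].
have /eqP c0 : count p s == 0%N.
  rewrite -leqn0 leqNgt -has_count; apply/hasP => -[x xs px].
  case/splitPr: xs H {IH} => s1 s2 H.
  by have := H (b :: s1) x s2 erefl px; rewrite /= (negbTE pb).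
by rewrite c0; apply/nilP; rewrite /nilp size_filter c0.
Qed.

Section Step.
Context (s : seq 'I_N) (a : 'I_N) (w : seq 'I_N).
Hypothesis srt : sorted lt_ord (rev s ++ a :: w).

Let ltsa x : x \in s -> (x < a)%N.
Proof.
move=> xs; have := srt; rewrite sorted_pairwise; last exact: lt_ord_trans.
rewrite pairwise_cat => /and3P[/allrelP H _ _].
by apply: H; rewrite ?mem_rev// mem_head.
Qed.

Let ltaw x : x \in w -> (a < x)%N.
Proof.
move=> xw; have := srt; rewrite sorted_pairwise; last exact: lt_ord_trans.
by rewrite pairwise_cat => /and3P[_ _ /= /andP[/allP H _]]; exact: H.
Qed.

Let lts s1 s2 x y : s = s1 ++ s2 -> x \in s1 -> y \in s2 -> (y < x)%N.
Proof.
move=> E xs ys; have := srt; rewrite sorted_pairwise; last exact: lt_ord_trans.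
rewrite E rev_cat -catA pairwise_cat => /and3P[/allrelP H _ _].
by apply: H; rewrite ?mem_cat ?mem_rev// xs.
Qed.

(** The block closed by [a] when it pops [r] letters. *)
Definition top r : {set 'I_N} := [set x in a :: take r s].

Lemma uniq_as : uniq (a :: s).
Proof.
have : uniq (rev s ++ a :: w).
  by apply: sorted_uniq srt; [exact: lt_ord_trans | move=> x; exact: ltnn].
by rewrite -cat_rcons -rev_cons cat_uniq rev_uniq => /andP[].
Qed.

Lemma card_top r : (r <= size s)%N -> #|top r| = r.+1.
Proof.
move=> rs; rewrite cardsE; have /card_uniqP-> : uniq (a :: take r s).
  by apply: subseq_uniq uniq_as; rewrite /= eqxx take_subseq.
by rewrite /= size_takel.
Qed.

Lemma rev_enum_top r : rev (enum (top r)) = a :: take r s.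
Proof.
rewrite -[RHS]revK; congr rev.
apply: (@irr_sorted_eq _ lt_ord) => //; first exact: lt_ord_trans.
- by move=> x; exact: ltnn.
- apply: sorted_filter; first exact: lt_ord_trans.
  have := iota_ltn_sorted 0 N; rewrite -val_enum_ord sorted_map.
  by rewrite enumT.
- apply: subseq_sorted srt; first exact: lt_ord_trans.
  rewrite rev_cons -cat_rcons -[X in subseq X _]cats0 cat_subseq ?sub0seq//.
  rewrite -{2}(cat_take_drop r s) rev_cat rcons_cat; exact: suffix_subseq.
by move=> x; rewrite mem_enum inE mem_rev.
Qed.

Lemma pending_push P :
  pending (a :: s) w P =
  pending s (a :: w) P && open_in w P.
Proof.
rewrite /pending (_ : [set x in (a :: s) ++ w] = [set x in s ++ a :: w]);
  last first.
  by apply/setP => x; rewrite !inE !mem_cat !inE orbCA.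
case: partition => //=; case: noncrossing => //=.
apply/idP/andP => [H|[]//]; split => //; apply/forall_inP => V VP.
have /exists_inP[x xV xw] := forall_inP H _ VP.
by apply/exists_inP; exists x => //; rewrite inE xw orbT.
Qed.

(** A block closed at [a] is an interval on the top of the stack: a letter that
it skips belongs to a block with a later element, hence would cross it. *)
Lemma block_top P V : pending s (a :: w) P -> V \in P ->
    (forall x, x \in V -> x \notin w) ->
  [/\ a \in V, (#|V|.-1 <= size s)%N & V = top #|V|.-1].
Proof.
move=> /pendingP[pP nP oP] VP Vw.
have aV : a \in V.
  have [x xV] := oP _ VP; rewrite inE => /predU1P[<-//|xw].
  by have := Vw _ xV; rewrite xw.
have Vsub x : x \in V -> (x == a) || (x \in s).
  move=> xV; have := fintype.subsetP (partitionS pP VP) _ xV.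
  rewrite inE mem_cat inE orbCA => /orP[->//|];
    rewrite (negbTE (Vw _ xV)) orbF => ->.
  by rewrite orbT.
have E : [seq x <- s | x \in V] = take (count (mem V) s) s.
  apply: filter_prefix => s1 x s2 E xV; apply/allP => y ys1.
  apply/negPn/negP => yV.
  have yD : y \in cover P.
    by rewrite (cover_partition pP) inE mem_cat E mem_cat ys1.
  have WP := pblock_mem yD; have yW : y \in pblock P y by rewrite mem_pblock.
  have [z zW] := oP _ WP; rewrite inE => /predU1P[za|zw].
    have VW : V != pblock P y by apply: contraNneq yV => ->.
    have := trivIsetP (partition_trivIset pP) _ _ VP WP VW.
    by rewrite disjoint_subset => /fintype.subsetP/(_ _ aV); rewrite inE -za zW.
  have xy : (x < y)%N by apply: (lts E ys1); rewrite mem_head.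
  have ya : (y < a)%N by apply: ltsa; rewrite E mem_cat ys1.
  have xya : (x < y < a)%N by rewrite xy.
  have VE := noncrossingP _ nP _ _ _ _ _ _ VP WP xya (ltaw zw) xV aV yW zW.
  by rewrite VE yW in yV.
have VE : V = top (count (mem V) s).
  apply/setP => x; rewrite !inE -E mem_filter.
  apply/idP/idP => [xV|/predU1P[->//|/andP[]//]].
  by rewrite xV andTb Vsub.
have cs := count_size (mem V) s.
by rewrite {2 3 4}VE card_top//; split => //; rewrite VE card_top.
Qed.

Lemma top_w r x : x \in top r -> x \notin w.
Proof.
rewrite !inE => /predU1P[->|/mem_take/ltsa xa]; apply/negP => /ltaw;
  rewrite ?ltnn//.
by rewrite ltnNge ltnW.
Qed.

(** Conversely the closed block can be added back without crossings, since each
of the other letters, deeper in the stack or unread, lies outside the interval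
that it spans. *)
Lemma pending_pop r Q : (r <= size s)%N -> top r \notin Q ->
  pending s (a :: w) (top r |: Q) = pending (drop r s) w Q.
Proof.
move=> rs VQ.
have Etd : s = take r s ++ drop r s by rewrite cat_take_drop.
have disj : [disjoint top r & [set x in drop r s ++ w]].
  apply/pred0P => x /=; apply/negP => /andP[xV]; rewrite inE mem_cat.
  rewrite (negbTE (top_w xV)) orbF => xd.
  move: xV; rewrite !inE => /predU1P[xa|xt].
    by have := ltsa (mem_drop xd); rewrite xa ltnn.
  by have := lts Etd xt xd; rewrite ltnn.
have DE : [set x in s ++ a :: w] = top r :|: [set x in drop r s ++ w].
  apply/setP => x; rewrite {1}Etd !inE !mem_cat !inE.
  by case: (x \in take r s); case: (x \in drop r s); case: (x == a);
    case: (x \in w).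
have ord x y : x \in top r -> y \in [set x in drop r s ++ w] ->
    (y \in drop r s) && (y < x)%N || (y \in w) && (x < y)%N.
  rewrite !inE mem_cat => xV /orP[yd|yw]; apply/orP; [left|right].
    rewrite yd; case/predU1P: xV => [->|xt]; first exact: ltsa (mem_drop yd).
    exact: lts Etd xt yd.
  rewrite yw; case/predU1P: xV => [->|/mem_take/ltsa xa]; first exact: ltaw.
  exact: ltn_trans xa (ltaw yw).
have ordlt x x' y : x \in top r -> x' \in top r ->
  y \in [set x in drop r s ++ w] ->
    (x < y)%N -> (x' < y)%N.
  move=> xV x'V yD xy; have := ord _ _ xV yD; have := ord _ _ x'V yD.
  case/orP => /andP[yd yx'] // /orP[/andP[_ yx]|/andP[yw _]].
    by rewrite ltnNge (ltnW yx) in xy.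
  by have := ltn_trans (ltaw yw) (ltsa (mem_drop yd)); rewrite ltnn.
apply/pendingP/pendingP => -[pP nP oP].
  have pQ : partition Q [set x in drop r s ++ w].
    have := partitionD1 pP (setU11 _ _); rewrite setU1K// DE setDUl setDv set0U.
    by rewrite (setDidPl _)// disjoint_sym.
  split=> //.
    apply/noncrossingP => V W i j k l VQ' WQ' ij kl.
    by apply: (noncrossingP _ nP) ij kl; rewrite inE ?VQ' ?WQ' orbT.
  move=> V VQ'; have [|x xV] := oP V; first by rewrite inE VQ' orbT.
  rewrite inE => /predU1P[xa|xw]; last by exists x.
  have := partitionS pQ VQ' => /fintype.subsetP/(_ _ xV) aD.
  by move/pred0P: disj => /(_ x); rewrite /= aD xa !inE eqxx.
split.
- rewrite DE; apply: partitionU1 => //; apply/set0Pn; exists a.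
  by rewrite !inE eqxx.
- have QD V x : V \in Q -> x \in V -> x \in [set x in drop r s ++ w].
    by move=> VQ'; exact/fintype.subsetP/(partitionS pP).
  apply/noncrossingP => V W i j k l; rewrite !in_setU1.
  move=> /predU1P[->|VQ'] /predU1P[->|WQ']//; last exact: (noncrossingP _ nP).
    move=> /andP[ij jk] kl iV kV jW lW.
    by have := ordlt _ _ _ iV kV (QD _ _ WQ' jW) ij; rewrite ltnNge ltnW.
  move=> /andP[ij jk] kl iV kV jW lW.
  by have := ordlt _ _ _ jW lW (QD _ _ VQ' kV) jk; rewrite ltnNge ltnW.
move=> V; rewrite in_setU1 => /predU1P[->|/oP[x xV xw]].
  by exists a; rewrite ?inE ?eqxx.
by exists x; rewrite // inE xw orbT.
Qed.

Lemma top_notin r Q : pending (drop r s) w Q -> top r \notin Q.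
Proof. by move=> /pendingP[_ _ oQ]; apply/negP => /oQ[x /top_w/negP]. Qed.

Lemma closed_block r P : (r <= size s)%N -> pending s (a :: w) P ->
  (top r \in P) = ~~ open_in w P && (#|pblock P a|.-1 == r).
Proof.
move=> rs pP; have [pPD _ oP] := pendingP _ _ _ pP.
apply/idP/andP => [rP|[]].
  split.
    by apply/negP => /forall_inP/(_ _ rP)/exists_inP[x /top_w/negP].
  rewrite (def_pblock (partition_trivIset pPD) rP) ?card_top//.
  by rewrite !inE eqxx.
rewrite negb_forall_in => /exists_inP[V VP];
  rewrite negb_exists_in => /forall_inP Vw.
have [aV _ VE] := block_top pP VP Vw.
rewrite (def_pblock (partition_trivIset pPD) VP aV) => /eqP rE.
by rewrite -rE -VE.
Qed.

Lemma closed_size P : pending s (a :: w) P -> ~~ open_in w P ->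
  (#|pblock P a|.-1 <= size s)%N.
Proof.
move=> pP; have [pPD _ _] := pendingP _ _ _ pP.
rewrite negb_forall_in => /exists_inP[V VP];
  rewrite negb_exists_in => /forall_inP Vw.
have [aV Vs _] := block_top pP VP Vw.
by rewrite (def_pblock (partition_trivIset pPD) VP aV).
Qed.

End Step.

(** The recursion of the stack on the partition side: either [a] is not the last
element of its block, and it is pushed, or it is, and its block is [top r] for
one [r]. *)
Lemma fock_pending (C : comNzRingType) (kap : seq 'I_N -> C) s w :
    sorted lt_ord (rev s ++ w) ->
  fock kap w s =
  \sum_(P | pending s w P) \prod_(V in P) kap (rev (enum V)).
Proof.
elim: w s => [|a w IH] s srt.
  under eq_bigl do rewrite pending_nil.
  case: s {srt} => [|c s]; last by rewrite big_pred0.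
  by rewrite (big_pred1 set0)// big_set0.
rewrite /= /step IH; last by rewrite rev_cons cat_rcons.
rewrite [RHS](bigID (open_in w))/=.
congr (_ + _); first by apply: eq_bigl => P; rewrite pending_push.
(* the number of popped letters is read off from the block of a *)
rewrite (partition_big (fun P =>
  inord (#|pblock P a|.-1) : 'I_(size s).+1) predT)//=.
apply: eq_bigr => r _; rewrite IH; last first.
  apply: subseq_sorted srt; first exact: lt_ord_trans.
  have -> : rev s = rev (drop r s) ++ rev (take r s).
    by rewrite -rev_cat cat_take_drop.
  rewrite -catA cat_subseq// -cat_rcons; exact: suffix_subseq.
have rs : (r <= size s)%N by rewrite -ltnS.
transitivity (\sum_(P | pending s (a :: w) P && (top s a r \in P))
    \prod_(V in P) kap (rev (enum V))); last first.
  apply: eq_bigl => P; have [pP|] := boolP (pending _ _ _) => //=.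
  rewrite (closed_block srt)//; have [//|nP] := boolP (open_in w P).
  by rewrite -val_eqE/= inordK// ltnS (closed_size srt).
rewrite mulr_sumr [RHS](reindex_onto (fun Q => top s a r |: Q) (fun P =>
  P :\ top s a r)); last first.
  by move=> P /andP[_ /setD1K].
apply: eq_big => [Q|Q pQ]; last first.
  by rewrite big_setU1 ?(top_notin srt)// (rev_enum_top srt).
rewrite setU11 andbT; have [VQ|VQ] := boolP (top s a r \in Q).
  rewrite [_ == Q]negbTE ?andbF; last first.
    by apply: contraTneq VQ => <-; rewrite setD11.
  by apply/negP => /(top_notin srt); rewrite VQ.
by rewrite (pending_pop srt)// setU1K// eqxx andbT.
Qed.

End NonCrossing.

(** The moment-cumulant formula: the blocks of a non-crossing partition are
closed by their last elements. *)
Theorem mom_noncrossing (C : comNzRingType) (A : Type) (kap : seq A -> C)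
    (s : seq A) :
  mom kap s = \sum_(P in NC (size s)) \prod_(V in P)
    kap (rev [seq tnth (in_tuple s) i | i <- enum V]).
Proof.
have -> : mom kap s = mom (fun t =>
  kap (map (tnth (in_tuple s)) t)) (enum 'I_(size s)).
  have Es : map (tnth (in_tuple s)) (enum 'I_(size s)) = s.
    exact: (map_tnth_enum (in_tuple s)).
  rewrite -[in LHS]Es /mom; symmetry.
  by apply: (@fock_map _ _ _ (tnth (in_tuple s)) predT _ kap _ [::])=> //;
    rewrite all_predT.
rewrite /mom fock_pending.
  apply: eq_big => P; last by move=> _; apply: eq_bigr => V _; rewrite map_rev.
  rewrite inE; apply/pendingP/andP.
    move=> [pP nP _]; split => //.
    by move: pP; congr (finset.partition _ _); apply/setP => x;
      rewrite !inE mem_enum.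
  move=> [pP nP]; split => //.
    by move: pP; congr (finset.partition _ _); apply/setP => x;
      rewrite !inE mem_enum.
  move=> V VP; have /set0Pn[x xV] := partition_neq0 pP VP.
  by exists x => //; rewrite mem_enum.
rewrite cat0s; have := iota_ltn_sorted 0 (size s).
by rewrite -val_enum_ord sorted_map.
Qed.

(** * The free algebra *)

Section FreeAlgebra.
Context (C : comNzRingType) (A : choiceType).

(** An alias of the monoid algebra of the free monoid, which carries the algebra
structure. *)
Definition free_alg := monalg.malg (monalg.fmonom A) C.

HB.instance Definition _ := GRing.Lalgebra.on free_alg.

Definition word (w : seq A) : free_alg :=
  monalg.mkmalgU (monalg.fmonom_of_seq monalg.fmonom_key w) 1.

Definition gen (a : A) : free_alg := word [:: a].

Lemma word_nil : word [::] = 1.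
Proof. by []. Qed.

Lemma word_cat w1 w2 : word (w1 ++ w2) = word w1 * word w2.
Proof.
rewrite /word [RHS]monalg.fgmulUU mulr1; congr (monalg.mkmalgU _ _).
by rewrite /monalg.mmul /= monalg.fmmulE !monalg.fmE.
Qed.

Lemma word_prod w : word w = \prod_(a <- w) gen a.
Proof.
elim: w => [|a w IH]; first by rewrite big_nil.
by rewrite big_cons -IH -word_cat.
Qed.

Lemma free_algE (P : free_alg) :
  P = \sum_(w <- monalg.msupp P) monalg.mcoeff w P *: word w.
Proof.
rewrite {1}[P]monalg.monalgE; apply: eq_bigr => w _.
apply/monalg.malgP => v; rewrite monalg.mcoeffZ /word monalg.fmE monalg.fmK.
by rewrite !monalg.mcoeffU; case: eqP; rewrite ?mulr1// mulr0.
Qed.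

Lemma scale_word (c : C) w :
  c *: word w =
  monalg.mkmalgU (monalg.fmonom_of_seq monalg.fmonom_key w) c :> free_alg.
Proof.
apply/monalg.malgP => v; rewrite monalg.mcoeffZ !monalg.mcoeffU.
by case: eqP; rewrite ?mulr1// mulr0.
Qed.

Fact free_alg_scaleAr (c : C) (P Q : free_alg) : c *: (P * Q) = P * (c *: Q).
Proof.
rewrite [P]free_algE !mulr_suml scaler_sumr; apply: eq_bigr => v _.
rewrite [Q]free_algE mulr_sumr [LHS]scaler_sumr scaler_sumr mulr_sumr.
apply: eq_bigr => w _.
rewrite -!scalerAl !scalerA [in LHS]scale_word [in RHS]scale_word.
rewrite [X in _ *: X = _]monalg.fgmulUU [X in _ = _ *: X]monalg.fgmulUU !mul1r.
rewrite -!scale_word !scalerA; congr (_ *: _); ring.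
Qed.

HB.instance Definition _ :=
  GRing.Lalgebra_isAlgebra.Build C free_alg free_alg_scaleAr.

End FreeAlgebra.

Section Extension.
Context (C : comNzRingType) (A : choiceType) (V : lmodType C).

(** The linear extension of a function of words. *)
Definition wordsum (f : seq A -> V) (P : free_alg C A) : V :=
  \sum_(w <- monalg.msupp P) monalg.mcoeff w P *: f w.

Lemma wordsumEw (f : seq A -> V)
    (d : finmap.finset_of (Phant (monalg.fmonom A))) (P : free_alg C A) :
  finmap.fsubset (monalg.msupp P) d ->
  wordsum f P = \sum_(w <- d) monalg.mcoeff w P *: f w.
Proof.
move=> le; rewrite [LHS](finmap.big_fset_incl _ le) => //= x xd.
by move=> /monalg.mcoeff_outdom ->; rewrite scale0r.
Qed.

Lemma wordsum_linear f : linear (wordsum f).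
Proof.
move=> c P Q.
pose d := finmap.fsetU (finmap.fsetU (monalg.msupp P) (monalg.msupp Q))
  (monalg.msupp (c *: P + Q)).
have dP : finmap.fsubset (monalg.msupp P) d.
  by rewrite /d -finmap.fsetUA finmap.fsubsetUl.
have dQ : finmap.fsubset (monalg.msupp Q) d.
  by rewrite /d [finmap.fsetU (monalg.msupp P) _]finmap.fsetUC -finmap.fsetUA
    finmap.fsubsetUl.
rewrite !(@wordsumEw _ d)// ?finmap.fsubsetUr// scaler_sumr -big_split/=.
by apply: eq_bigr => w _; rewrite monalg.mcoeffD monalg.mcoeffZ scalerDl
  scalerA.
Qed.

HB.instance Definition _ f :=
  GRing.isLinear.Build C (free_alg C A) V *:%R (wordsum f) (wordsum_linear f).

Lemma wordsum_word f w : wordsum f (word C w) = f w.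
Proof.
rewrite (wordsumEw _ monalg.msuppU_le) finmap.big_seq_fset1 monalg.mcoeffUU.
by rewrite scale1r monalg.fmE.
Qed.

End Extension.

Section Evaluation.
Context (C : comNzRingType) (A : choiceType) (X : algType C) (x : A -> X).

Definition ev : free_alg C A -> X := wordsum (fun w => \prod_(a <- w) x a).

HB.instance Definition _ := GRing.Linear.on ev.

Lemma ev_word w : ev (word C w) = \prod_(a <- w) x a.
Proof. exact: wordsum_word. Qed.

Lemma ev_scale c P : ev (c *: P) = c *: ev P.
Proof. exact: linearZ. Qed.

Lemma ev_wordM v w : ev (word C v * word C w) = ev (word C v) * ev (word C w).
Proof. by rewrite -word_cat !ev_word big_cat. Qed.

Lemma ev_monoid_morphism : monoid_morphism ev.
Proof.
split; first by rewrite -word_nil ev_word big_nil.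
move=> P Q; rewrite [Q]free_algE mulr_sumr !linear_sum /= [RHS]mulr_sumr.
apply: eq_bigr => w _; rewrite -(scalerAr _ P).
apply: etrans (ev_scale _ _) _; apply/esym.
apply: etrans (congr1 (fun y => ev P * y) (ev_scale _ _)) _.
rewrite -[LHS]scalerAr; congr (_ *: _).
rewrite [P]free_algE [X in _ = ev X]mulr_suml !linear_sum /= [LHS]mulr_suml.
apply: eq_bigr => v _; rewrite -(scalerAl _ (word C v)); apply/esym.
apply: etrans (ev_scale _ _) _; apply/esym.
apply: etrans (congr1 (fun y => y * ev (word C w)) (ev_scale _ _)) _.
by rewrite -[LHS]scalerAl; congr (_ *: _); exact/esym/ev_wordM.
Qed.

HB.instance Definition _ :=
  GRing.isMonoidMorphism.Build (free_alg C A) X ev ev_monoid_morphism.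

End Evaluation.

Section Scalar.
Context (C : comNzRingType) (A : choiceType) (mu : seq A -> C).

(** [wordsum] into the regular module; the scaling of a linear form is the
product of the ring, hence a separate instance. *)
Definition extend : free_alg C A -> C := wordsum (V := C^o) mu.

Lemma extend_is_scalar : scalable_for *%R extend.
Proof. by move=> c P; rewrite /extend linearZ. Qed.
Lemma extend_is_additive : additive extend.
Proof. by move=> P Q; rewrite /extend linearB. Qed.
HB.instance Definition _ := GRing.isAdditive.Build (free_alg C A) C extend
  extend_is_additive.
HB.instance Definition _ := GRing.isScalable.Build C (free_alg C A) C *%R extend
  extend_is_scalar.

Lemma extend_word w : extend (word C w) = mu w.
Proof. by rewrite /extend wordsum_word. Qed.
End Scalar.

(** * Freeness from vanishing mixed cumulants *)

Lemma foldr_step_sum (C : comNzRingType) (A J : Type) (kap : seq A -> C)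
    (r : seq J) (c : J -> C) (g : J -> seq A -> C) w s :
  foldr (step kap) (fun t => \sum_(j <- r) c j * g j t) w s =
  \sum_(j <- r) c j * foldr (step kap) (g j) w s.
Proof.
elim: w s => [//|a w IH] s /=.
under [RHS]eq_bigr do rewrite /step mulrDr.
rewrite /step IH big_split/=; congr (_ + _).
under [RHS]eq_bigr do rewrite /conv mulr_sumr.
rewrite exchange_big/=; apply: eq_bigr => i _.
by rewrite IH mulr_sumr; apply: eq_bigr => j _; rewrite mulrCA.
Qed.

Section Action.
Context (C : comNzRingType) (A : choiceType) (kap : seq A -> C).

(** The Fock representation of the free algebra on functions of the stack. *)
Definition act (P : free_alg C A) (g : seq A -> C) (s : seq A) : C :=
  extend (fun w => foldr (step kap) g w s) P.

Lemma act_word w g s : act (word C w) g s = foldr (step kap) g w s.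
Proof. exact: extend_word. Qed.

Lemma act_linear c P Q g s : act (c *: P + Q) g s = c * act P g s + act Q g s.
Proof. by rewrite /act linearP. Qed.

Lemma act_wordM v Q g s :
  act (word C v * Q) g s = foldr (step kap) (act Q g) v s.
Proof.
rewrite [in LHS](free_algE Q) mulr_sumr /act linear_sum/=.
transitivity (\sum_(w <- monalg.msupp Q) monalg.mcoeff w Q *
    foldr (step kap) (foldr (step kap) g w) v s).
  apply: eq_bigr => w _; rewrite -(scalerAr _ (word C v)) linearZ/=.
  by rewrite -word_cat extend_word foldr_cat.
by rewrite -foldr_step_sum.
Qed.

Lemma actM P Q g s : act (P * Q) g s = act P (act Q g) s.
Proof.
rewrite [in LHS](free_algE P) mulr_suml /act linear_sum/=.
apply: eq_bigr => v _; rewrite -(scalerAl _ (word C v)) linearZ/=.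
by congr (_ * _); exact: act_wordM.
Qed.

Lemma act1 g s : act 1 g s = g s.
Proof. by rewrite -word_nil act_word. Qed.

Lemma actZ c P g s : act P (fun t => c * g t) s = c * act P g s.
Proof.
rewrite /act /extend /wordsum /= mulr_sumr; apply: eq_bigr => w _.
by rewrite foldr_stepZ /GRing.scale/= mulrCA.
Qed.

Lemma act_vac P : act P (vac C (A := A)) [::] = extend (mom kap) P.
Proof. by []. Qed.

End Action.

Section Model.
Context (R : realType) (A : choiceType).

Definition moment_space (mu : seq A -> R[i]) (mu1 : mu [::] = 1) : ncps R.
Proof.
refine (@NCPS R (free_alg R[i] A) (extend mu) _).
exact: etrans (extend_word mu [::]) mu1.
Defined.

Definition polys_in (p : pred A) : set (free_alg R[i] A) :=
  generated_subalgebra (fun P => exists2 a, p a & P = gen R[i] a).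

(** Locality is stable under linear combinations and composition, so it passes
from the letters to the algebra that they generate. *)
Lemma polys_in_local (kap : seq A -> R[i]) (p : pred A) (P : free_alg R[i] A) :
    (forall a t, p a -> ~~ all p t -> kap (a :: t) = 0) ->
  polys_in p P -> local_on p (act kap P).
Proof.
move=> kap0.
apply: (smallest_sub (X := [set Q | local_on p (act kap Q)]%classic)); last first.
  move=> _ [a pa ->] g h u w pu pw E; rewrite !act_word/=.
  by apply: (local_step (p := p)) => // t; exact: kap0.
split=> [|c Q Q'|Q Q'] /=.
- by move=> g h u w pu pw E; rewrite !act1 E.
- move=> lQ lQ' g h u w pu pw E.
  by rewrite !act_linear (lQ g h u w)// (lQ' g h u w).
- move=> lQ lQ' g h u w pu pw E; rewrite !actM.
  by apply: (lQ _ _ u w) => // u' pu'; exact: (lQ' g h u' w).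
Qed.

(** If [g] vanishes as soon as the top segment of colour [p] is not empty, then on
the stacks that a local operator reaches [g] is a multiple of the vacuum, on
which a centred operator has expectation zero. *)
Lemma local_zero (kap : seq A -> R[i]) (p : pred A) (P : free_alg R[i] A)
    (g : seq A -> R[i]) w :
  local_on p (act kap P) -> extend (mom kap) P = 0 ->
  (if w is b :: _ then ~~ p b else true) ->
  (forall u, all p u -> (0 < size u)%N -> g (u ++ w) = 0) ->
  act kap P g w = 0.
Proof.
move=> lP P0 pw g0; rewrite -[w]cat0s (lP g (fun u => g w * vac R[i] u) [::] w)//.
  by rewrite actZ act_vac P0 mulr0.
case=> [|a u] pu; first by rewrite mulr1.
by rewrite g0// mulr0.
Qed.

(** By induction on the number of factors: started on a stack whose top letter
does not have the colour of the first factor, an alternating product of centred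
elements comes back to the empty stack with total weight zero. Indeed the first
factor, being centred, leaves letters of its own colour on the top, and the next
factor has another colour. *)
Theorem fock_free (I : eqType) (col : A -> I) (kap : seq A -> R[i])
    (m1 : mom kap [::] = 1) :
    (forall a t, ~~ all (fun b => col b == col a) t -> kap (a :: t) = 0) ->
  free_subalgebras (X := moment_space m1)
    (fun i => polys_in (fun a => col a == i)).
Proof.
move=> kap0 k i x k0 Hx Hi.
suff H w : (if w is b :: _ then col b != i 0 else true) ->
    act kap (\prod_(0 <= j < k) x j : free_alg R[i] A) (vac R[i] (A := A)) w = 0.
  exact: (H [::]).
elim: k i x k0 Hx Hi w => // k IH i x _ Hx Hi w cw.
have [B0 P0] := Hx 0 isT.
rewrite big_nat_recl// actM;
  apply: (local_zero (p := fun a => col a == i 0)) => //.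
  apply: polys_in_local B0 => a t /eqP pa nt; apply: kap0; by rewrite pa.
move=> u pu u0; case: k IH Hx Hi => [|k] IH Hx Hi.
  rewrite big_geq// act1 /vac; case: u u0 {pu} => //.
apply: (IH (fun j => i j.+1) (fun j => x j.+1)) => //.
- by move=> j jk; exact: Hx.
- by move=> j jk; exact: Hi.
case: u u0 pu => // b u _ /= /andP[/eqP-> _]; apply/eqP; exact: (Hi 0).
Qed.

End Model.

(** * Free families have the moments of the Fock model *)

Lemma generated_unital (R : realType) (X : algType R[i]) (G : set X) :
  unital_subalgebra (generated_subalgebra G).
Proof.
split=> [|c x y Gx Gy|x y Gx Gy] Y YG; have [[Y1 YL YM] GY] := YG.
- exact: Y1.
- exact: YL (Gx _ YG) (Gy _ YG).
- exact: YM (Gx _ YG) (Gy _ YG).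
Qed.

Lemma not_sorted (T : Type) (e : rel T) (s : seq T) : ~~ sorted e s ->
  exists s1 x y s2, s = s1 ++ x :: y :: s2 /\ ~~ e x y.
Proof.
elim: s => //= x [|y s] IH //=;
  rewrite negb_and => /orP[xy|/IH[s1 [z [t [s2 [E zt]]]]]].
  by exists [::], x, y, s.
by exists (x :: s1), z, t, s2; rewrite E.
Qed.

Lemma split_centring (C : comNzRingType) (V : algType C) (x y z : V) (c : C) :
  x * (y * z) = c *: (x * z) + x * (y - c *: 1) * z.
Proof.
by rewrite mulrBr mulrBl -scalerAr mulr1 -scalerAl addrC mulrA subrK.
Qed.

Section Uniqueness.
Context (R : realType) (X : ncps R) (I A : choiceType) (col : A -> I).
Context (kap : seq A -> R[i]) (B : I -> set X) (x : A -> X).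
Hypothesis m1 : mom kap [::] = 1.
Hypothesis kap0 : forall a t, ~~ all (fun b => col b == col a) t ->
  kap (a :: t) = 0.
Hypothesis Bunital : forall i, unital_subalgebra (B i).
Hypothesis Bfree : free_subalgebras B.
Hypothesis xB : forall a, B (col a) (x a).
Hypothesis marginal : forall i w, all (fun a => col a == i) w ->
  mom kap w = 'phi (\prod_(a <- w) x a).

Let agree (P : free_alg R[i] A) := extend (mom kap) P = 'phi (ev x P).
Let poly i := polys_in (R := R) (fun a : A => col a == i).

Let agree_linear c P Q : agree P -> agree Q -> agree (c *: P + Q).
Proof. by rewrite /agree !linearP /= => -> ->. Qed.

Let poly_unital i : unital_subalgebra (poly i).
Proof. exact: generated_unital. Qed.

Let poly_ev i P : poly i P -> B i (ev x P).
Proof.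
have [B1 BL BM] := Bunital i.
apply: (smallest_sub (X := [set Q | B i (ev x Q)]%classic)).
  split=> [|c Q Q' bQ bQ'|Q Q' bQ bQ'] /=.
  - by rewrite rmorph1.
  - by rewrite linearP; exact: BL.
  - by rewrite rmorphM; exact: BM.
move=> _ [a /eqP <- ->] /=; rewrite /gen ev_word big_seq1; exact: xB.
Qed.

(** Agreement on words passes to the polynomials of one colour. Agreement is not
stable under products, but multiplying by a polynomial preserves the [Z] such
that both states agree on [Z] times any word of that colour. *)
Let poly_agree i P : poly i P -> agree P.
Proof.
move=> Pi; pose L Z := forall u, all (fun a => col a == i) u ->
  agree (Z * word R[i] u).
have LL c Z Z' : L Z -> L Z' -> L (c *: Z + Z').
  by move=> lZ lZ' u pu; rewrite mulrDl -(scalerAl c Z); apply: agree_linear;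
    [exact: lZ | exact: lZ'].
suff H : (poly i `<=` [set P | forall Z, L Z -> L (Z * P)])%classic.
  have L1 : L 1.
    by move=> u pu; rewrite mul1r /agree [LHS]extend_word (marginal pu) ev_word.
  by have := H P Pi 1 L1 [::] isT; rewrite mul1r word_nil mulr1.
apply: smallest_sub.
  split=> [|c Q Q' lQ lQ'|Q Q' lQ lQ'] Z lZ.
  - by rewrite mulr1.
  - by rewrite mulrDr -(scalerAr c Z); apply: LL; [exact: lQ | exact: lQ'].
  - by rewrite mulrA; apply: lQ'; exact: lQ.
move=> _ [a pa ->] Z lZ u pu; rewrite -mulrA -word_cat; apply: lZ.
by rewrite /= pa.
Qed.

Let fprod (fs : seq (I * free_alg R[i] A)) := \prod_(f <- fs) f.2.
Let cen (f : I * free_alg R[i] A) : I * free_alg R[i] A :=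
  (f.1, f.2 - (extend (mom kap) f.2) *: 1).

Let cen_poly f : poly f.1 f.2 -> poly f.1 (cen f).2.
Proof.
have [P1 PL _] := poly_unital f.1.
by move=> Pf; rewrite /cen /= addrC -scaleNr; exact: PL.
Qed.

Let agree1 : agree 1.
Proof. by rewrite /agree rmorph1 state1 -[RHS]m1 -word_nil extend_word. Qed.

Let alternating_agree fs :
  (forall f, f \in fs -> poly f.1 f.2 /\ extend (mom kap) f.2 = 0) ->
  sorted (fun f g => f.1 != g.1) fs -> agree (fprod fs).
Proof.
case: fs => [|f0 fs].
  by move=> _ _; rewrite /fprod big_nil; exact: agree1.
move: (f0 :: fs) (isT : (0 < size (f0 :: fs))%N) => {}fs fs0 pfs srt.
have P0 j : (j < size fs)%N -> poly (nth f0 fs j).1 (nth f0 fs j).2 /\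
    extend (mom kap) (nth f0 fs j).2 = 0.
  by move=> jk; apply: pfs; exact: mem_nth.
have alt j : (j.+1 < size fs)%N -> (nth f0 fs j).1 <> (nth f0 fs j.+1).1.
  by move=> jk; apply/eqP; exact: (sortedP f0 srt).
rewrite /agree /fprod (big_nth f0) rmorph_prod.
transitivity (0 : R[i]); last symmetry.
  exact: (fock_free (m1 := m1) kap0 (i := fun j => (nth f0 fs j).1)
    (x := fun j => (nth f0 fs j).2)).
apply: (Bfree (i := fun j => (nth f0 fs j).1)
  (x := fun j => ev x (nth f0 fs j).2)) => // j jk.
have [Pj Pj0] := P0 j jk; split; first exact: poly_ev.
by rewrite -(poly_agree Pj).
Qed.

Let fprod_cat f1 f2 : fprod (f1 ++ f2) = fprod f1 * fprod f2.
Proof. by rewrite /fprod big_cat. Qed.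

Let fprod1 f : fprod [:: f] = f.2.
Proof. by rewrite /fprod big_seq1. Qed.

Let fprod_cons f fs : fprod (f :: fs) = f.2 * fprod fs.
Proof. by rewrite /fprod big_cons. Qed.

(** Induction on the number of factors. Two neighbours of the same colour are
merged; in an alternating product the factors are centred one after another,
each centring leaving a multiple of a product with one factor less. *)
Let all_agree fs : (forall f, f \in fs -> poly f.1 f.2) -> agree (fprod fs).
Proof.
have [n] := ubnP (size fs); elim: n fs => // n IH fs sn pfs.
have [srt|/not_sorted[s1 [f [g [s2 [E /negPn/eqP fg]]]]]] :=
    boolP (sorted (fun f g => f.1 != g.1) fs); last first.
  have -> : fprod fs = fprod (s1 ++ (f.1, f.2 * g.2) :: s2).
    rewrite E (fprod_cat s1) (fprod_cat s1); congr (_ * _).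
    by rewrite !fprod_cons /=; exact: mulrA.
  apply: IH; first by move: sn; rewrite E !size_cat/= !addnS ltnS.
  move=> h; rewrite mem_cat inE => /or3P[hs|/eqP->|hs] /=.
  - by apply: pfs; rewrite E mem_cat hs.
  - have [_ _ PM] := poly_unital f.1; apply: PM.
      by apply: pfs; rewrite E mem_cat mem_head orbT.
    by rewrite fg; apply: pfs; rewrite E mem_cat !inE eqxx !orbT.
  - by apply: pfs; rewrite E mem_cat !inE hs !orbT.
suff H f1 f2 : f1 ++ f2 = fs -> agree (fprod (map cen f1) * fprod f2).
  by have := H [::] fs erefl; rewrite /fprod big_nil mul1r.
elim: f2 f1 => [|f f2 IH2] f1 E.
  rewrite /(fprod [::]) big_nil mulr1; apply: alternating_agree.
    move=> _ /mapP[f ff1 ->]; split.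
      have pf : poly f.1 f.2 by apply: pfs; rewrite -E cats0.
      exact: (cen_poly pf).
    have lin1 : extend (mom kap) 1 = 1 by exact: etrans (extend_word _ [::]) m1.
    by rewrite linearB/= linearZ/= lin1 mulr1 subrr.
  by rewrite sorted_map; move: srt; rewrite -E cats0.
have -> : fprod (map cen f1) * fprod (f :: f2) =
    (extend (mom kap) f.2) *: fprod (map cen f1 ++ f2) +
    fprod (map cen (rcons f1 f)) * fprod f2.
  rewrite fprod_cons map_rcons -cats1 (fprod_cat (map cen f1) f2).
  rewrite (fprod_cat (map cen f1) [:: _]) fprod1 /=; exact: split_centring.
apply: agree_linear; last by apply: IH2; rewrite cat_rcons.
apply: IH; first by move: sn; rewrite -E !size_cat size_map/= addnS ltnS.
move=> h; rewrite mem_cat => /orP[/mapP[h' hf1 ->]|hf2].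
  have ph : poly h'.1 h'.2 by apply: pfs; rewrite -E mem_cat hf1.
  exact: (cen_poly ph).
by apply: pfs; rewrite -E mem_cat inE hf2 !orbT.
Qed.

Theorem free_mom w : mom kap w = 'phi (\prod_(a <- w) x a).
Proof.
have := @all_agree [seq (col a, gen R[i] a) | a <- w].
rewrite /agree /fprod big_map/= -word_prod extend_word ev_word; apply.
move=> _ /mapP[a _ ->] /=; apply: sub_gen_smallest.
by exists a.
Qed.

End Uniqueness.

(** * Limits of cumulants *)

Section Limits.
Context (R : realType).
Local Open Scope classical_set_scope.

Definition clim (u : nat -> R[i]) (l : R[i]) : Prop :=
  (fun n => u n : R[i]^o) @ \oo --> (l : R[i]^o).

Lemma clim_cst c : clim (fun=> c) c.
Proof. exact: cvg_cst. Qed.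

Lemma climD u v l m : clim u l -> clim v m -> clim (fun n => u n + v n) (l + m).
Proof. by move=> ul vm; exact: (cvgD ul vm). Qed.

Lemma climM u v l m : clim u l -> clim v m -> clim (fun n => u n * v n) (l * m).
Proof. by move=> ul vm; exact: (cvgM ul vm). Qed.

Lemma clim_sum (J : Type) (r : seq J) (u : J -> nat -> R[i]) (l : J -> R[i]) :
  (forall j, clim (u j) (l j)) ->
  clim (fun n => \sum_(j <- r) u j n) (\sum_(j <- r) l j).
Proof.
move=> ul; elim: r => [|j r IH].
  by rewrite big_nil; under [X in clim X]eq_fun do rewrite big_nil;
    exact: clim_cst.
rewrite big_cons; under [X in clim X]eq_fun do rewrite big_cons.
exact: (climD (ul j) IH).
Qed.

Lemma clim_unique u l m : clim u l -> clim u m -> l = m.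
Proof. exact: (@cvg_unique _ (@norm_hausdorff _ R[i]^o)). Qed.

Lemma near_eq_clim u v l N : (forall n, (N <= n)%N -> u n = v n) ->
  clim v l -> clim u l.
Proof.
move=> uv; apply: cvg_trans; apply: near_eq_cvg.
by near=> n; rewrite uv//; near: n; exact: nbhs_infty_ge.
Unshelve. all: by end_near. Qed.

Lemma clim_invn : clim (fun n => n%:R^-1) 0.
Proof.
apply/cvgrPdist_lt => /= e e0.
have [eR /= Re0] : e \is Num.real /\ 0 < complex.Re e.
  by split; [exact: gtr0_real | move: e0; rewrite ltcE => /andP[]].
have eE : e = (complex.Re e)%:C by rewrite RRe_real.
near=> n.
have n0 : (0 < n%:R :> R).
  apply: lt_trans (_ : (complex.Re e)^-1 < _); first by rewrite invr_gt0.
  near: n; exact: nbhs_infty_gtr.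
rewrite sub0r normrN normfV ger0_norm ?ler0n// eE.
rewrite -(rmorph_nat (@real_complex R)) -fmorphV ltcR.
rewrite invf_plt// ?posrE//; near: n; exact: nbhs_infty_gtr.
Unshelve. all: by end_near. Qed.

Section Fock.
Context (A : Type).
Implicit Types (kap : nat -> seq A -> R[i]) (K : seq A -> R[i]).

Lemma clim_conv (k g : nat -> seq A -> R[i]) (k0 g0 : seq A -> R[i]) s :
  (forall t, (size t <= size s)%N -> clim (k^~ t) (k0 t)) ->
  (forall t, (size t <= size s)%N -> clim (g^~ t) (g0 t)) ->
  clim (fun n => conv (k n) (g n) s) (conv k0 g0 s).
Proof.
move=> kk gg; rewrite /conv; apply: clim_sum => r; apply: climM.
  by apply: kk; rewrite size_take_min geq_minr.
by apply: gg; rewrite size_drop leq_subr.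
Qed.

Lemma clim_fock kap K w s :
  (forall t, (0 < size t <= size w + size s)%N -> clim (kap^~ t) (K t)) ->
  clim (fun n => fock (kap n) w s) (fock K w s).
Proof.
elim: w s => [|a w IH] s E; first exact: clim_cst.
apply: climD.
  by apply: IH => t Ht; apply: E; move: Ht => /=; lia.
apply: clim_conv => t Ht.
  by apply: E => /=; lia.
by apply: IH => v Hv; apply: E => /=; lia.
Qed.

Lemma fock0 (w s : seq A) : fock (fun=> 0) w s = (nilp w && nilp s)%:R :> R[i].
Proof.
elim: w s => [|a w IH] s //=; rewrite /step IH andbF add0r.
by rewrite /conv big1// => r _; rewrite mul0r.
Qed.

Lemma clim0_of_scaled kap (l : R[i]) t :
  clim (fun n => n%:R * kap n t) l -> clim (kap^~ t) 0.
Proof.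
move=> H; rewrite -(mul0r l).
apply: (@near_eq_clim _ (fun n => n%:R^-1 * (n%:R * kap n t)) _ 1); last first.
  exact: climM clim_invn H.
by move=> n n0; rewrite mulKf// pnatr_eq0 -lt0n.
Qed.

(** A run with at least two blocks carries at least two cumulants, each of order
[1 / n], so that after multiplication by [n] only the single block remains. *)
Lemma clim_fock_scaled kap K w s : (0 < size w)%N ->
  (forall t, (0 < size t < size w + size s)%N ->
    clim (fun n => n%:R * kap n t) (K t)) ->
  clim (fun n => n%:R * fock (kap n) w s - n%:R * kap n (rev w ++ s)) 0.
Proof.
case: w => // a w _; elim: w a s => [|b w IH] a s E.
  under [X in clim X]eq_fun do rewrite fock1 subrr.
  exact: clim_cst.
under [X in clim X]eq_fun => n.
  rewrite [fock _ _ _]/= {1}/step mulrDr addrAC rev_cons cat_rcons.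
  over.
rewrite -[0 : R[i]]addr0; apply: climD.
  by apply: IH => t Ht; apply: E; move: Ht => /=; lia.
apply: (@near_eq_clim _ (fun n => conv (fun t =>
  n%:R * kap n (a :: t)) (fock (kap n) (b :: w)) s) _ 0).
  by move=> n _; rewrite /conv mulr_sumr; apply: eq_bigr => r _; rewrite mulrA.
have -> : 0 = conv (fun t => K (a :: t)) (fock (fun=> 0) (b :: w)) s.
  by rewrite /conv big1// => r _; rewrite fock0 mulr0.
apply: clim_conv => t Ht; first by apply: E => /=; lia.
apply: clim_fock => v Hv; apply: (clim0_of_scaled (l := K v)); apply: E => /=.
by move: Hv => /=; lia.
Qed.

Lemma clim_cumulants_of (mu : nat -> seq A -> R[i]) (m : seq A -> R[i]) :
    (forall w, (0 < size w)%N -> clim (fun n => n%:R * mu n w) (m w)) ->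
  forall t, (0 < size t)%N ->
    clim (fun n => n%:R * cumulants_of (mu n) t) (m (rev t)).
Proof.
move=> H t; have [k] := ubnP (size t); elim: k t => // k IH t tk t0.
have := @clim_fock_scaled (fun n =>
  cumulants_of (mu n)) (m \o rev) (rev t) [::].
rewrite size_rev revK cats0 => /(_ t0) L.
have {}L : clim (fun n => n%:R * mu n (rev t) - n%:R * cumulants_of (mu n) t) 0.
  apply: (near_eq_clim (N := 0)) (L _) => [n _|v Hv].
    by rewrite -/(mom _ _) mom_cumulants_of// size_rev.
  by apply: IH; move: Hv => /=; lia.
have := climD (H (rev t) _) (climM (@clim_cst (-1)) L).
rewrite size_rev mulr0 addr0 => /(_ t0); apply: (near_eq_clim (N := 0)) => n _.
by rewrite mulN1r opprB addrC subrK.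
Qed.

End Fock.
End Limits.

(** * Moments of the array *)

Lemma nceval_ev (R : realType) (k : nat) (X : ncps R) (x : k.-tuple X)
    (P : ncpoly R k) :
  nceval x P = ev (tnth x) P.
Proof. by apply: eq_bigr => w _; rewrite mulr_algl. Qed.

Lemma cvg_in_distributionP (R : realType) (k : nat) (X : nat -> ncps R)
    (x : forall n, k.-tuple (X n)) (Y : ncps R) (y : k.-tuple Y) :
  cvg_in_distribution x y <-> forall w : seq 'I_k,
    clim (fun n => 'phi (\prod_(i <- w) tnth (x n) i))
         ('phi (\prod_(i <- w) tnth y i)).
Proof.
split=> [H w|H P].
  have := H (word R[i] w); rewrite nceval_ev ev_word.
  by apply: (near_eq_clim (N := 0)) => n _; rewrite nceval_ev ev_word.
have phiE (Z : ncps R) (z : k.-tuple Z) : 'phi (nceval z P) =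
    \sum_(w <- monalg.msupp P) monalg.mcoeff w P *
      'phi (\prod_(i <- monalg.fmonom_val w) tnth z i).
  rewrite nceval_ev /ev /wordsum linear_sum; apply: eq_bigr => w _.
  by rewrite linearZ.
rewrite phiE; apply: (@near_eq_clim _ _ (fun n => \sum_(w <- monalg.msupp P)
  monalg.mcoeff w P * 'phi (\prod_(i <- monalg.fmonom_val w) tnth (x n) i)) _ 0).
  by move=> n _; exact: phiE.
by apply: clim_sum => w; apply: climM; [exact: clim_cst | exact: H].
Qed.

Section Array.
Context (R : realType) (X : ncps R) (a b : X).

(** The two letters [a b] and [a - a b] out of which [S] and [N - S] are made. *)
Definition letter (A : algType R[i]) (u v : A) (d : 'I_2) : A :=
  if d == ord0 then u * v else u - u * v.

Definition letter_poly (d : 'I_2) : {poly R[i]} :=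
  if d == ord0 then 'X else 1 - 'X.

Definition letter_mom w : R[i] := 'phi (\prod_(d <- w) letter a b d).

Lemma ev_letter (x : 2.-tuple X) d :
  ev (tnth x) (letter (gen R[i] ord0) (gen R[i] (inord 1)) d) =
  letter (tnth x ord0) (tnth x (inord 1)) d.
Proof.
by rewrite /letter; case: ifP => _;
  rewrite ?rmorphB ?rmorphM /gen/= !ev_word !big_seq1.
Qed.

Lemma letter_mom_copy (a' b' : X) w :
  same_joint_distribution [tuple a'; b'] [tuple a; b] ->
  'phi (\prod_(d <- w) letter a' b' d) = letter_mom w.
Proof.
move=> H.
have E (x y : X) : \prod_(d <- w) letter x y d = nceval [tuple x; y]
    (\prod_(d <- w) letter (gen R[i] ord0) (gen R[i] (inord 1)) d :
      free_alg R[i] 'I_2).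
  rewrite nceval_ev rmorph_prod; apply: eq_bigr => d _.
  by apply/esym/(etrans (ev_letter _ d)); rewrite !(tnth_nth x)/= inordK.
by rewrite /letter_mom !E H.
Qed.

Lemma horner_algE (q : {poly R[i]}) :
  horner_alg b q = \sum_(i < size q) q`_i *: b ^+ i.
Proof.
rewrite /horner_alg /= /horner_morph horner_coef size_map_poly.
by apply: eq_bigr => i _; rewrite coef_map mulr_algl.
Qed.

Lemma phi_horner (q : {poly R[i]}) k : classically_independent a b ->
  'phi (a ^+ k * horner_alg b q) = 'phi (a ^+ k) * 'phi (horner_alg b q).
Proof.
move=> [_ H]; rewrite horner_algE mulr_sumr !linear_sum/= mulr_sumr.
apply: eq_bigr => i _.
by rewrite -scalerAr !linearZ/= H mulrCA.
Qed.

Lemma prod_letter w : a * b = b * a ->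
  \prod_(d <- w) letter a b d =
    a ^+ size w * horner_alg b (\prod_(d <- w) letter_poly d).
Proof.
move=> ab; elim: w => [|d w IH]; first by rewrite !big_nil rmorph1 mulr1.
have L : letter a b d = a * horner_alg b (letter_poly d).
  rewrite /letter /letter_poly; case: ifP => _; first by rewrite horner_algX.
  by rewrite rmorphB rmorph1 /= horner_algX mulrBr mulr1.
rewrite !big_cons IH L rmorphM/= exprS !mulrA; congr (_ * _).
rewrite -!mulrA; congr (_ * _); apply: commrX.
rewrite horner_algE /GRing.comm mulr_suml mulr_sumr; apply: eq_bigr => i _.
by rewrite -scalerAl -scalerAr; congr (_ *: _); exact/commr_sym/commrX.
Qed.

(** [a] commutes with [b], so a word of letters is [a ^+ k] times a polynomial
in [b]; the Bernoulli moments of [a] do not depend on [k > 0]. *)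
Lemma letter_mom_horner p w : classically_independent a b -> bernoulli p a ->
  (0 < size w)%N ->
  letter_mom w = p%:C * 'phi (horner_alg b (\prod_(d <- w) letter_poly d)).
Proof.
move=> ab [_ Ba] w0.
by rewrite /letter_mom prod_letter ?phi_horner ?Ba//; case: ab.
Qed.

(** The copies [(a_ i, b_ i)] form a free family of [n] colours with the cumulants
of the letters, and these are additive. *)
Theorem array_moments n (a_ b_ : 'I_n -> X) w : free_copies a b a_ b_ ->
  'phi (\prod_(d <- w) \sum_i letter (a_ i) (b_ i) d) =
  mom (fun t => n%:R * cumulants_of letter_mom t) w.
Proof.
move=> [dist free].
rewrite (state_prod_sum (state X) (fun z => letter (a_ z.1) (b_ z.1) z.2)).
pose kap := cumulants_of letter_mom.
pose B i := generated_subalgebra [set a_ i; b_ i]%classic.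
transitivity (colour_sum (mom (monochrome (I := 'I_n) kap)) w).
  apply: eq_colour_sum => t; symmetry.
  apply: (free_mom (col := fst) (B := B)) => //.
  - by move=> z u /= /negbTE->.
  - by move=> i; exact: generated_unital.
  - move=> [i d] /=; have [_ L M] : unital_subalgebra (B i).
      exact: generated_unital.
    have Ga : B i (a_ i) by apply: sub_gen_smallest; left.
    have Gb : B i (b_ i) by apply: sub_gen_smallest; right.
    rewrite /letter; case: ifP => _; first exact: M.
    by rewrite addrC -scaleN1r; apply: L => //; exact: M.
  move=> i u ui.
  have -> : \prod_(z <- u) letter (a_ z.1) (b_ z.1) z.2 =
      \prod_(d <- map snd u) letter (a_ i) (b_ i) d.
    rewrite big_map big_seq [RHS]big_seq; apply: eq_bigr => z zu.
    by rewrite (eqP (allP ui z zu)).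
  rewrite (letter_mom_copy _ (dist i)) /mom.
  rewrite (fock_map (f := snd) (p := fun z => z.1 == i) (kap' := kap))//=.
    case: u {ui} => [|z u]; first by rewrite /letter_mom big_nil state1.
    by rewrite -[LHS]/(mom _ _) mom_cumulants_of.
  move=> z v /andP[/eqP zi vi]; rewrite (_ : all _ v)//.
  by rewrite zi.
rewrite colour_sum_mom /mom; apply: eq_fock => t /andP[t0 _].
by rewrite colour_sum_monochrome// card_ord.
Qed.

End Array.

(** * The limit of the array *)

(** The limit of [n] times the cumulant of a word of letters. *)
Definition limit_cumulant (R : realType) (lambda : R) (X : ncps R) (b : X)
    (t : seq 'I_2) : R[i] :=
  lambda%:C * 'phi (horner_alg b (\prod_(d <- t) letter_poly R d)).

Section LimitTheorem.
Context (R : realType) (lambda : R) (lambda_gt0 : 0 < lambda)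
    (X : nat -> ncps R) (a b : forall n, X n)
    (a_ b_ : forall n, 'I_n -> X n).
Hypotheses (ab_indep : forall n, lambda <= n%:R ->
       classically_independent (a n) (b n))
    (a_bernoulli : forall n, lambda <= n%:R ->
       bernoulli (lambda / n%:R) (a n))
    (b_distribution : forall n n' : nat, lambda <= n%:R -> lambda <= n'%:R ->
       forall m : nat, (1 <= m)%N -> 'phi (b n ^+ m) = 'phi (b n' ^+ m))
    (copies : forall n, lambda <= n%:R ->
       free_copies (a n) (b n) (@a_ n) (@b_ n)).

Lemma phi_horner_b n n' (q : {poly R[i]}) : lambda <= n%:R -> lambda <= n'%:R ->
  'phi (horner_alg (b n) q) = 'phi (horner_alg (b n') q).
Proof.
move=> hn hn'; rewrite !horner_algE !linear_sum; apply: eq_bigr => -[[|i] hi] _.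
  by rewrite !linearZ /= !expr0 !state1.
by rewrite !linearZ/= (@b_distribution n n').
Qed.

Lemma limit_moments n0 w : lambda <= n0%:R ->
  clim (fun n => 'phi (\prod_(d <- w) \sum_(i < n) letter (a_ i) (b_ i) d))
       (mom (limit_cumulant lambda (b n0)) w).
Proof.
move=> hn0; pose N := Num.bound lambda.
have hN n : (N <= n)%N -> lambda <= n%:R.
  move=> Nn; apply: le_trans (ltW (archi_boundP (ltW lambda_gt0))) _.
  by rewrite ler_nat.
pose kap n := fun t => n%:R * cumulants_of (letter_mom (a n) (b n)) t.
apply: (@near_eq_clim _ _ (fun n => mom (kap n) w) _ N).
  by move=> n /hN hn; rewrite (array_moments _ (copies hn)).
apply: clim_fock => t /andP[t0 _]; rewrite /kap.
have -> : limit_cumulant lambda (b n0) t = limit_cumulant lambda (b n0) (rev t).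
  by rewrite /limit_cumulant big_rev.
apply: (clim_cumulants_of (mu := fun n =>
  letter_mom (a n) (b n)) (m := limit_cumulant lambda (b n0))) => // v v0.
apply: (@near_eq_clim _ _ (fun=> limit_cumulant lambda (b n0) v) _ N);
  last exact: clim_cst.
move=> n /hN hn; rewrite (letter_mom_horner (ab_indep hn) (a_bernoulli hn) v0).
rewrite (phi_horner_b _ hn hn0) /limit_cumulant mulrA; congr (_ * _).
have n0' : n%:R != 0 :> R by rewrite gt_eqF// (lt_le_trans lambda_gt0).
by rewrite -(rmorph_nat (@real_complex R)) -rmorphM mulrC divfK.
Qed.

End LimitTheorem.

Section PureCumulants.
Context (R : realType) (lambda : R) (X : ncps R) (b : X).
Let K := limit_cumulant lambda b.

Lemma limit_cumulant_nseq r : K (nseq r ord0) = lambda%:C * 'phi (b ^+ r).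
Proof.
by rewrite /K /limit_cumulant big_nseq -/(_ ^+ _) iter_mulr_1 rmorphXn/=
  horner_algX.
Qed.

End PureCumulants.

(** * Free Poisson variables *)

Section Poisson.
Context (R : realType) (X : ncps R).

Definition prod_state (s : seq X) : R[i] := 'phi (\prod_(x <- s) x).

Lemma free_cumulants_mom (kappa : seq X -> R[i]) s :
  free_cumulants kappa -> (0 < size s)%N -> mom (kappa \o rev) s = prod_state s.
Proof.
move=> [_ H] s0; rewrite /prod_state H// mom_noncrossing.
by apply: eq_bigr => P _; apply: eq_bigr => V _; rewrite /= revK.
Qed.

Lemma multilinear_prod_state : multilinear prod_state.
Proof.
move=> s1 s2 c x y; rewrite /prod_state !big_cat !big_cons/=.
by rewrite mulrDl mulrDr -scalerAl -scalerAr linearP.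
Qed.

(** The cumulants attached to the moments of the whole algebra, taken as an
alphabet, satisfy the moment-cumulant formula, and the stack recursion makes
them multilinear. *)
Lemma free_cumulants_exist : free_cumulants (cumulants_of prod_state \o rev).
Proof.
split; first exact: multilinear_rev (multilinear_cumulants_of
  multilinear_prod_state).
move=> s s0; rewrite -[LHS]/(prod_state s) -(mom_cumulants_of _ s0)
  mom_noncrossing.
by apply: eq_bigr => P _; apply: eq_bigr => V _.
Qed.

Definition poisson_cumulant (mu alpha : R) (t : seq unit) : R[i] :=
  (mu * alpha ^+ size t)%:C.

Lemma map_const (A B : Type) (p : A) (w : seq B) :
  map (fun=> p) w = nseq (size w) p.
Proof. by elim: w => //= b w ->. Qed.

(** Free Poisson variables are those whose moments are computed from the cumulants
[mu * alpha ^+ r]; the letters of the alphabet [unit] only count occurrences. *)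
Lemma free_poissonP mu alpha (p : X) : free_poisson mu alpha p <->
  forall w, (0 < size w)%N ->
    'phi (p ^+ size w) = mom (poisson_cumulant mu alpha) w.
Proof.
have pw (w : seq unit) : prod_state (map (fun=> p) w) = 'phi (p ^+ size w).
  by rewrite /prod_state map_const big_nseq iter_mulr_1.
have mw (kappa : seq X -> R[i]) (w : seq unit) :
    mom (kappa \o rev) (map (fun=> p) w) =
    mom (fun t => kappa (nseq (size t) p)) w.
  symmetry; apply: (fock_map (f := fun=> p) (p := predT) (s := [::]));
    rewrite ?all_predT//.
  by move=> u t _; rewrite [RHS]/comp -map_rev map_const size_rev.
split=> [[kappa [kc kp]] w w0|H].
  rewrite -pw -(free_cumulants_mom kc) ?size_map// mw.
  by apply: eq_fock => t /andP[t0 _]; rewrite kp.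
exists (cumulants_of prod_state \o rev); split;
  first exact: free_cumulants_exist.
move=> r r0; have := @mom_inj _ _ (fun t =>
  (cumulants_of prod_state \o rev) (nseq (size t) p)) (poisson_cumulant mu
  alpha).
move=> /(_ _ (nseq r tt)); rewrite /poisson_cumulant !size_nseq => E;
  apply: E => // w w0.
rewrite -mw -H// -pw -(mom_cumulants_of prod_state) ?size_map//.
by rewrite /mom; apply: eq_fock => t _; rewrite /= revK.
Qed.
End Poisson.

(** * The two characterisations *)

Section Binary.
Context (R : realType) (X : ncps R) (b : X).

Lemma phi_letter_mixed (q : {poly R[i]}) :
    (forall m, (1 <= m)%N -> 'phi (b ^+ m) = 'phi b) ->
  'phi (horner_alg b ('X * (1 - 'X) * q)) = 0.
Proof.
move=> Hb.
rewrite rmorphM rmorphM rmorphB rmorph1 /= !horner_algX horner_algE.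
rewrite mulr_sumr linear_sum big1// => i _; rewrite -scalerAr linearZ/=.
rewrite mulrBr mulr1 mulrBl -mulrA -!exprS linearB/= !Hb// subrr mulr0//.
Qed.

Lemma letter_poly_mixed (d e : 'I_2) : e != d ->
  letter_poly R d * letter_poly R e = 'X * (1 - 'X).
Proof.
rewrite /letter_poly; case: (eqVneq d ord0) => [->|d0] de.
  by rewrite (negbTE de).
have -> : e == ord0.
  move: d0 de; case: d => [[|[|//]] ?]; case: e => [[|[|//]] ?];
    rewrite -!val_eqE//=.
by rewrite mulrC.
Qed.

(** A word with both letters contributes a multiple of ['X * (1 - 'X)]. *)
Lemma limit_cumulant_mixed (lambda : R) d t :
    (forall m, (1 <= m)%N -> 'phi (b ^+ m) = 'phi b) ->
    ~~ all (fun e => e == d) t -> limit_cumulant lambda b (d :: t) = 0.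
Proof.
move=> Hb /allPn[e et ed];
  rewrite /limit_cumulant big_cons (big_rem e)//= mulrA.
by rewrite letter_poly_mixed// phi_letter_mixed// mulr0.
Qed.

Lemma limit_cumulant_edge (lambda : R) m :
  limit_cumulant lambda b (ord_max :: nseq m ord0) =
  lambda%:C * ('phi (b ^+ m) - 'phi (b ^+ m.+1)).
Proof.
rewrite /limit_cumulant big_cons big_nseq iter_mulr_1; congr (_ * _).
rewrite rmorphM rmorphB rmorph1 rmorphXn/= horner_algX.
by rewrite mulrBl mul1r -exprS linearB.
Qed.
End Binary.

Unset Implicit Arguments.

Theorem theorem6p3 (R : realType) (lambda : R) (lambda_gt0 : 0 < lambda)
    (X : nat -> ncps R) (a b : forall n, X n)
    (a_ b_ : forall n, 'I_n -> X n)
    (ab_indep : forall n, lambda <= n%:R ->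
       classically_independent (a n) (b n))
    (a_bernoulli : forall n, lambda <= n%:R ->
       bernoulli (lambda / n%:R) (a n))
    (b_distribution : forall n n' : nat, lambda <= n%:R -> lambda <= n'%:R ->
       forall m : nat, (1 <= m)%N -> 'phi (b n ^+ m) = 'phi (b n' ^+ m))
    (copies : forall n, lambda <= n%:R ->
       free_copies (a n) (b n) (a_ n) (b_ n)) :
  let N := fun n => \sum_(i < n) a_ n i in
  let S := fun n => \sum_(i < n) a_ n i * b_ n i in
  (forall mu alpha : R, 0 < mu -> 0 < alpha ->
     (asymptotically_free_poisson S mu alpha <->
      forall n, lambda <= n%:R -> forall m : nat, (1 <= m)%N ->
        'phi (((alpha^-1)%:C *: b n) ^+ m) = (mu / lambda)%:C)) /\
  (asymptotically_free (fun n => [tuple S n; N n - S n]) <->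
   forall n, lambda <= n%:R -> forall m : nat, (1 <= m)%N ->
     'phi (b n ^+ m) = 'phi (b n)).
Proof.
move=> N S.
have letterE n (w : seq 'I_2) :
    \prod_(d <- w) tnth [tuple S n; N n - S n] d =
    \prod_(d <- w) \sum_(i < n) letter (a_ n i) (b_ n i) d.
  apply: eq_bigr => d _; rewrite /letter (tnth_nth (S n)).
  case: d => [[|[|//]] hd] /=; rewrite -?val_eqE//=.
  by rewrite -sumrB.
have limits n0 : lambda <= n0%:R -> forall w,
    clim (fun n => 'phi (\prod_(d <- w) tnth [tuple S n; N n - S n] d))
         (mom (limit_cumulant lambda (b n0)) w).
  move=> hn0 w.
  apply: (@near_eq_clim _ _ (fun n => 'phi (\prod_(d <- w)
    \sum_(i < n) letter (a_ n i) (b_ n i) d)) _ 0); first by move=> n _;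
      rewrite letterE.
  exact: (limit_moments lambda_gt0 ab_indep a_bernoulli b_distribution copies).
(* b has the same moments at every index, so one index fixes the limit *)
have [n0 hn0] : exists n0, lambda <= n0%:R.
  by exists (Num.bound lambda); exact/ltW/archi_boundP/ltW.
have lambda0 : lambda%:C != 0 :> R[i].
  by rewrite -(rmorph0 (@real_complex R)) (inj_eq (fmorph_inj _)) gt_eqF.
split=> [mu_ al mu0 al0|].
  pose K := limit_cumulant lambda (b n0).
  pose K1 (t : seq unit) := K (map (fun=> ord0) t).
  have limS (w : seq unit) : clim (fun n => 'phi (S n ^+ size w)) (mom K1 w).
    have -> : mom K1 w = mom K (map (fun=> ord0) w).
      by apply: (fock_map (f := fun=> ord0) (p := predT) (s := [::]));
        rewrite ?all_predT.
    apply: (@near_eq_clim _ _ (fun n => 'phi (\prod_(d <- map (fun=> ord0) w)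
      tnth [tuple S n; N n - S n] d)) _ 0); last exact: limits.
    by move=> n _; rewrite big_map big_const_seq count_predT iter_mulr_1.
  have tnth1 (Y : ncps R) (p : Y) (w : seq 'I_1) :
      \prod_(i <- w) tnth [tuple p] i = p ^+ size w.
    elim: w => [|i w IH]; first by rewrite big_nil.
    by rewrite big_cons IH exprS (tnth_nth p) (ord1 i).
  have cvgS (Y : ncps R) (p : Y) :
      cvg_in_distribution (fun n => [tuple S n]) [tuple p] <->
      forall w, 'phi (p ^+ size w) = mom K1 w.
    split=> [/cvg_in_distributionP H w|H].
      apply: clim_unique (limS w).
      pose u : seq 'I_1 := map (fun=> ord0) w.
      have uw : size u = size w by rewrite size_map.
      have := H u; rewrite (tnth1 Y p u) uw.
      apply: (@near_eq_clim _ _ (fun n =>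
        'phi (\prod_(i <- u) tnth [tuple S n] i)) _ 0).
      by move=> n _; rewrite (tnth1 _ (S n) u) uw.
    apply/cvg_in_distributionP => w; rewrite (tnth1 Y p w).
    pose u := map (fun=> tt) w; have uw : size u = size w by rewrite size_map.
    rewrite -uw H; apply: (@near_eq_clim _ _ (fun n =>
      'phi (S n ^+ size u)) _ 0).
      by move=> n _; rewrite (tnth1 _ (S n) w) uw.
    exact: limS.
  have afp : asymptotically_free_poisson S mu_ al <->
      forall t, (0 < size t)%N -> K1 t = poisson_cumulant mu_ al t.
    split=> [[Y [p [/free_poissonP pp /cvgS H]]]|H].
      by apply: mom_inj => w w0; rewrite -H pp.
    have EK (w : seq unit) : mom K1 w = mom (poisson_cumulant mu_ al) w.
      by apply: eq_fock => t /andP[t0 _]; exact: H.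
    pose Y := @moment_space R unit (mom (poisson_cumulant mu_ al)) erefl.
    have gE w : 'phi ((gen R[i] tt : Y) ^+ size w) =
      mom (poisson_cumulant mu_ al) w.
      rewrite -[RHS]extend_word word_prod; congr (extend _ _).
      by elim: w => [|[] w IH]; rewrite ?big_nil// big_cons exprS IH.
    exists Y, (gen R[i] tt); split; first by apply/free_poissonP => w _;
      exact: gE.
    by apply/cvgS => w; rewrite gE EK.
  have K1E r : K1 (nseq r tt) = lambda%:C * 'phi (b n0 ^+ r).
    by rewrite /K1 map_const size_nseq [LHS]limit_cumulant_nseq.
  have scale n m : (('phi (((al^-1)%:C *: b n) ^+ m) = (mu_ / lambda)%:C) <->
      lambda%:C * 'phi (b n ^+ m) = (mu_ * al ^+ m)%:C).
    rewrite exprZn linearZ /= -rmorphXn/= exprVn.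
    have al0' : (al ^+ m)%:C != 0 :> R[i].
      by rewrite -(rmorph0 (@real_complex R)) (inj_eq (fmorph_inj _))
        expf_neq0// gt_eqF.
    rewrite fmorphV !rmorphM /= fmorphV /=; set x := 'phi _.
    rewrite mulrC -[X in X <-> _]/(x / _ = _); split=> H.
      have -> : x = mu_%:C / lambda%:C * (al ^+ m)%:C by rewrite -H divfK.
      by rewrite mulrA mulrCA divff// mulr1.
    by apply: (mulfI lambda0); rewrite mulrA H mulrCA divff// mulr1 mulfK.
  apply: iff_trans afp _; split=> [H n hn m m0|H t t0].
    apply/scale; rewrite (b_distribution n n0)// -K1E H ?size_nseq//.
    by rewrite /poisson_cumulant size_nseq.
  have -> : t = nseq (size t) tt by elim: t {t0} => //= -[] t <-.
  rewrite K1E /poisson_cumulant size_nseq; apply/scale; exact: H.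
split=> [[Y [y [yfree /cvg_in_distributionP yc]]] n hn m m0|H].
  pose K := limit_cumulant lambda (b n).
  have E w : mom K w = 'phi (\prod_(d <- w) tnth y d).
    exact: clim_unique (limits n hn w) (yc w).
  (* the cumulants that freeness of the limit imposes *)
  pose K0 (t : seq 'I_2) := if t is d :: t' then
    if all (fun e => e == d) t' then K t else 0 else 0.
  have K0E t : (0 < size t)%N -> K0 t = K t.
    apply: mom_inj => w _; rewrite E.
    apply: (free_mom (col := id) (B := fun i =>
      generated_subalgebra [set tnth y i]%classic)) => //.
    - by move=> d u /= /negbTE->.
    - by move=> i; exact: generated_unital.
    - by move=> d; apply: sub_gen_smallest.
    move=> i u ui; rewrite -E.
    rewrite /mom [LHS](fock_map (f := id) (p := fun d =>
      d == i) (kap' := K)) ?map_id//.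
    move=> d v /= /andP[/eqP-> vi]; rewrite (_ : all _ v)// map_id//.
  have step k : (0 < k)%N -> 'phi (b n ^+ k.+1) = 'phi (b n ^+ k).
    move=> k0; have K00 : K0 (ord_max :: nseq k ord0) = 0 by case: k k0.
    have := K0E (ord_max :: nseq k ord0) isT.
    rewrite K00 [RHS]limit_cumulant_edge => /esym/eqP.
    by rewrite mulf_eq0 (negbTE lambda0) subr_eq0 => /eqP.
  by elim: m m0 => // -[|m] IH _; rewrite ?expr1// step// IH.
pose K := limit_cumulant lambda (b n0).
pose Y := @moment_space R 'I_2 (mom K) erefl.
exists Y, [tuple (gen R[i] i : Y) | i < 2]; split.
  have := @fock_free R 'I_2 'I_2 id K erefl
    (fun d t => @limit_cumulant_mixed R _ (b n0) lambda d t (H n0 hn0)).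
  rewrite /freely_independent /polys_in.
  congr free_subalgebras; apply/funext => i; congr generated_subalgebra.
  apply/seteqP; split=> [P [d /eqP-> ->]|P ->] /=; rewrite ?tnth_mktuple//.
  by exists i; rewrite ?tnth_mktuple.
apply/cvg_in_distributionP => w.
have -> : 'phi (\prod_(d <- w) tnth [tuple (gen R[i] i : Y) | i < 2] d) =
  mom K w.
  rewrite -[RHS]extend_word word_prod; congr (extend _ _).
  by apply: eq_bigr => d _; rewrite tnth_mktuple.
exact: limits.
Qed.
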